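(* Let $(\overline{x},\overline{\lambda})$ be a KKT point of the unperturbed problem, i.e. $(\overline{x},\overline{\lambda})\in\mathcal{S}_{\rm KKT}(0,0)$, with $\mathcal{M}(\overline{x},0,0)\neq\{\overline{\lambda}\}$. Suppose that the multifunction $\mathcal{F}(\cdot)=g(\cdot)-\mathcal{K}$ is metrically subregular at $\overline{x}$ for $0$. Define $$\Sigma(\overline{x},\overline{\lambda}):=\Big\{(\xi,\zeta)\in\mathbb{X}\times\mathbb{Y}:\ \nabla_{xx}^2L(\overline{x},\overline{\lambda})\xi+\nabla g(\overline{x})\big[\zeta+\tfrac12\nabla\Upsilon(g'(\overline{x})\xi)\big]=0\Big\},$$ $$\widetilde{\Gamma}(\overline{x},\overline{\lambda}):=\Big\{(\xi,\zeta)\in\mathbb{X}\times\mathbb{Y}:\ g'(\overline{x})\xi\in\mathcal{C}_{\mathcal{K}}(g(\overline{x}),\overline{\lambda}),\ \nabla g(\overline{x})\zeta\in\nabla g(\overline{x})\big(\mathcal{N}_{\mathcal{K}}(g(\overline{x}))+[\![\overline{\lambda}]\!]\big)\Big\}.$$ Suppose that $\langle g'(\overline{x})\xi,\zeta\rangle\ge0$ for any $(\xi,\zeta)\in\Sigma(\overline{x},\overline{\lambda})\cap\widetilde{\Gamma}(\overline{x},\overline{\lambda})$ and that ${\rm ri}(\mathcal{N}_{\mathcal{K}}(g(\overline{x})))\cap\mathcal{M}(\overline{x},0,0)\neq\emptyset$. If $\overline{\lambda}$ is noncritical, then $\mathcal{S}_{\rm KKT}$ has the strong calmness at $(0,0)$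 for $(\overline{x},\overline{\lambda})$.
   Context: Setting. $\mathbb{X},\mathbb{Y}$ are finite dimensional real vector spaces with inner product $\langle\cdot,\cdot\rangle$ and induced norm $\|\cdot\|$; $f:\mathbb{X}\to\mathbb{R}$ and $g:\mathbb{X}\to\mathbb{Y}$ are twice continuously differentiable; $\mathcal{K}\subseteq\mathbb{Y}$ is a nonempty closed convex set which is $C^2$-cone reducible: at every $\overline{y}\in\mathcal{K}$ there exist an open neighborhood $\mathcal{Y}$ of $\overline{y}$, a pointed closed convex cone $D$ in a finite dimensional space $\mathbb{Z}$, and a twice continuously differentiable $\Xi:\mathcal{Y}\to\mathbb{Z}$ with $\Xi(\overline{y})=0$, $\Xi'(\overline{y}):\mathbb{Y}\to\mathbb{Z}$ onto, and $\mathcal{K}\cap\mathcal{Y}=\{y\in\mathcal{Y}\mid\Xi(y)\in D\}$. The perturbed problem with parameter $(a,b)\in\mathbb{X}\times\mathbb{Y}$ is $\min_{x\in\mathbb{X}}\{f(x)-\langle a,x\rangle : g(x)-b\in\mathcal{K}\}$; the unperturbed problem has $(a,b)=(0,0)$. Notation. $h'(x)$ is the derivative of $h$ at $x$, $\nabla h(x)$ its adjoint, $h''(x)$ the second derivative. $L(x,\lambda):=f(x)+\langle\lambda,g(x)\rangle$, so $\nabla_xL(x,\lambda)=\nabla f(x)+\nabla g(x)\lambda$; $\nabla^2_{xx}L$ is its Hessian in $x$. $\mathcal{N}_{\mathcal{K}}$ and $\mathcal{T}_{\mathcal{K}}$ are the normal cone and the contingent (tangent) cone of $\mathcal{K}$;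 ${\rm ri}$ denotes relative interior; $[\![u]\!]$ is the linear span of $u$; $\mathbb{B}_{\delta}(z)$ is the closed ball of radius $\delta$ centered at $z$. The critical cone of $\mathcal{K}$ at $y\in\mathcal{K}$ with respect to $u\in\mathcal{N}_{\mathcal{K}}(y)$ is $\mathcal{C}_{\mathcal{K}}(y,u):=\mathcal{T}_{\mathcal{K}}(y)\cap u^{\perp}$. The function $\Upsilon$. Let $\overline{y}:=g(\overline{x})$, and let $\Xi,D$ be a reduction of $\mathcal{K}$ at $\overline{y}$, that is, $D$ is a pointed closed convex cone in a finite dimensional space $\mathbb{Z}$ and $\Xi:\mathcal{Y}\to\mathbb{Z}$ is a twice continuously differentiable mapping on an open neighborhood $\mathcal{Y}$ of $\overline{y}$ with $\Xi(\overline{y})=0$, $\Xi'(\overline{y}):\mathbb{Y}\to\mathbb{Z}$ onto, and $\mathcal{K}\cap\mathcal{Y}=\{y\in\mathcal{Y}\mid\Xi(y)\in D\}$; and let $\overline{\mu}\in\mathcal{N}_D(\Xi(\overline{y}))$ be the unique vector with $\overline{\lambda}=\nabla\Xi(\overline{y})\overline{\mu}$. Then $\Upsilon(h):=\langle\overline{\mu},\Xi''(\overline{y})(h,h)\rangle$; for $h\in\mathcal{C}_{\mathcal{K}}(\overline{y},\overline{\lambda})$ this equals $-\sigma(\overline{\lambda},\mathcal{T}^2_{\mathcal{K}}(\overline{y},h))$, where $\sigma(\overline{\lambda},\cdot)$ denotes the support function value at $\overline{\lambda}$ and $\mathcal{T}^2_{\mathcal{K}}(\overline{y},h)$ is the (outer)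 second order tangent set. KKT mappings. $\mathcal{S}_{\rm KKT}(a,b):=\{(x,\lambda)\in\mathbb{X}\times\mathbb{Y}\mid\nabla_xL(x,\lambda)=a,\ \lambda\in\mathcal{N}_{\mathcal{K}}(g(x)-b)\}$ and $\mathcal{M}(x,a,b):=\{\lambda\in\mathbb{Y}\mid(x,\lambda)\in\mathcal{S}_{\rm KKT}(a,b)\}$. Noncriticality. For a multifunction $\mathcal{F}$, the graphical derivative is defined by $\Delta w\in D\mathcal{F}(\overline{z}|\overline{w})(\Delta z)$ iff $(\Delta z,\Delta w)$ belongs to the contingent cone of ${\rm gph}\,\mathcal{F}$ at $(\overline{z},\overline{w})$. The multiplier $\overline{\lambda}\in\mathcal{M}(\overline{x},0,0)$ is noncritical if $\xi=0$ is the only solution of $0\in\nabla^2_{xx}L(\overline{x},\overline{\lambda})\xi+\nabla g(\overline{x})D\mathcal{N}_{\mathcal{K}}(g(\overline{x})|\overline{\lambda})(g'(\overline{x})\xi)$. Metric subregularity. A multifunction $\mathcal{F}:\mathbb{Z}\rightrightarrows\mathbb{W}$ is metrically subregular at $\overline{z}$ for $\overline{w}\in\mathcal{F}(\overline{z})$ if there exist $\kappa,\varepsilon,\delta>0$ such that ${\rm dist}(z,\mathcal{F}^{-1}(\overline{w}))\le\kappa\,{\rm dist}(\overline{w},\mathcal{F}(z)\cap\mathbb{B}_{\delta}(\overline{w}))$ for all $z\in\mathbb{B}_{\varepsilon}(\overline{z})$. Strong calmness. For $\mathcal{M}(\overline{x},0,0)\neq\{\overline{\lambda}\}$, $\mathcal{S}_{\rm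 KKT}$ has the strong calmness at the origin for $(\overline{x},\overline{\lambda})$ if there exist $\delta,\varepsilon,\kappa>0$ such that for any $(a,b)\in\mathbb{B}_{\delta}((0,0))$ and any $(x,\lambda)\in\mathcal{S}_{\rm KKT}(a,b)\cap\mathbb{B}_{\varepsilon}((\overline{x},\overline{\lambda}))$, $\|x-\overline{x}\|+{\rm dist}(\lambda,\mathcal{M}(\overline{x},0,0))\le\kappa\|(a,b)\|$. *)

(* Defs.v *)
From HB Require Import structures.
From mathcomp Require Import all_boot all_order all_algebra.
From mathcomp Require Import all_classical all_reals all_analysis.

Set Implicit Arguments.
Unset Strict Implicit.
Unset Printing Implicit Defensive.

Import Order.TTheory GRing.Theory Num.Theory.
Import numFieldNormedType.Exports.

Local Open Scope classical_set_scope.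
Local Open Scope ring_scope.

(* Finite dimensional real inner product spaces carrying the norm (and hence the
   topology and the calculus) induced by the inner product. Positive
   definiteness is contained in [inner_norm]. *)
HB.mixin Record NormedModule_hasInner (R : realType) E
    & NormedModule R E := {
  inner : E -> E -> R ;
  innerC : forall x y, inner x y = inner y x ;
  innerDl : forall x y z, inner (x + y) z = inner x z + inner y z ;
  innerZl : forall (a : R) x y, inner (a *: x) y = a * inner x y ;
  inner_norm : forall x, inner x x = `|x| ^+ 2
}.

#[short(type="euclideanType")]
HB.structure Definition Euclidean (R : realType) :=
  {E of NormedModule R E & Vector R E & NormedModule_hasInner R E}.

Section Calculus.
Context {R : realType}.

(* Representative of a linear form, and adjoint of a linear map. *)
Definition riesz {E : euclideanType R} (phi : E -> R) : E :=
  xget 0 [set v | forall x, inner v x = phi x].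

Definition adjoint {E F : euclideanType R} (A : E -> F) (y : F) : E :=
  riesz (fun x => inner y (A x)).

Definition gradient {E : euclideanType R} (h : E -> R) (x : E) : E :=
  riesz ('d h x).

Definition hessian {E : euclideanType R} (h : E -> R) (x : E) : E -> E :=
  'd (gradient h) x.

Definition diff2 {E F : normedModType R} (h : E -> F) (x u v : E) : F :=
  'd (fun z => 'd h z v) x u.

(* The derivative takes its values in a space of linear maps between finite
   dimensional spaces, whose topology is that of pointwise convergence: its
   differentiability, and the continuity of the second derivative, are therefore
   expressed on vectors. [U] is meant to be open. *)
Definition C2_on {E F : normedModType R} (U : set E) (h : E -> F) : Prop :=
  forall x, U x ->
    [/\ differentiable h x,
        forall v, differentiable (fun z => 'd h z v) x
      & forall u v, {for x, continuous (fun z => diff2 h z u v)}].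

End Calculus.

Section VariationalAnalysis.
Context {R : realType}.

Definition contingent_cone {E : normedModType R} (S : set E) (y : E) : set E :=
  [set d | exists (t : nat -> R) (d_ : nat -> E),
     [/\ forall k, 0 < t k, t @ \oo --> (0 : R), d_ @ \oo --> d
       & forall k, S (y + t k *: d_ k)]].

(* Normal cone of convex analysis, empty at the points outside [S]. *)
Definition normal_cone {E : euclideanType R} (S : set E) (y : E) : set E :=
  [set u | S y /\ forall z, S z -> inner u (z - y) <= 0].

Definition critical_cone {E : euclideanType R} (S : set E) (y u : E) : set E :=
  contingent_cone S y `&` [set d | inner d u = 0].

Definition affine_set {E : lmodType R} (A : set E) : Prop :=
  forall (t : R) x y, A x -> A y -> A ((1 - t) *: x + t *: y).

Definition affine_hull {E : lmodType R} (S : set E) : set E :=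
  smallest affine_set S.

Definition relative_interior {E : normedModType R} (S : set E) : set E :=
  [set x | S x /\ exists2 e : R, 0 < e & ball x e `&` affine_hull S `<=` S].

Definition line {E : lmodType R} (u : E) : set E := range (fun t : R => t *: u).

Definition graph {E F : Type} (Phi : E -> set F) : set (E * F) :=
  [set p | Phi p.1 p.2].

Definition graphical_derivative {E F : normedModType R} (Phi : E -> set F)
    (z : E) (w : F) (dz : E) : set F :=
  [set dw | contingent_cone (graph Phi) (z, w) (dz, dw)].

(* Extended real valued, so that the distance to the empty set is [+oo]. *)
Definition dist {E : normedModType R} (x : E) (S : set E) : \bar R :=
  ereal_inf [set (`|x - s|)%:E | s in S].

Definition metrically_subregular {E F : normedModType R} (Phi : E -> set F)
    (z : E) (w : F) : Prop :=
  Phi z w /\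
  exists kappa eps delta : R, [/\ 0 < kappa, 0 < eps, 0 < delta
    & forall x, closed_ball z eps x ->
        (dist x [set u | Phi u w]
           <= kappa%:E * dist w (Phi x `&` closed_ball w delta))%E].

Definition pointed_closed_convex_cone {E : normedModType R} (D : set E) : Prop :=
  [/\ closed D, convex_set (D : set (convex_lmodType E)),
      forall (t : R) d, 0 <= t -> D d -> D (t *: d)
    & D `&` [set - d | d in D] = [set 0]].

Definition is_C2_reduction {Y Z : euclideanType R} (K : set Y) (y : Y)
    (U : set Y) (D : set Z) (Xi : Y -> Z) : Prop :=
  [/\ open U /\ U y, pointed_closed_convex_cone D, C2_on U Xi,
      Xi y = 0 /\ range ('d Xi y) = setT
    & K `&` U = U `&` Xi @^-1` D].

Definition C2_cone_reducible {Y : euclideanType R} (K : set Y) : Prop :=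
  forall y, K y ->
    exists (Z : euclideanType R) (U : set Y) (D : set Z) (Xi : Y -> Z),
      is_C2_reduction K y U D Xi.

End VariationalAnalysis.

Section KKT.
Context {R : realType} {X Y : euclideanType R}.
Variables (f : X -> R) (g : X -> Y) (K : set Y).

Definition lagrangian (l : Y) (x : X) : R := f x + inner l (g x).

Definition S_KKT (a : X) (b : Y) : set (X * Y) :=
  [set p | gradient (lagrangian p.2) p.1 = a /\ normal_cone K (g p.1 - b) p.2].

Definition multipliers (x : X) (a : X) (b : Y) : set Y :=
  [set l | S_KKT a b (x, l)].

Definition noncritical (x : X) (l : Y) : Prop :=
  [set xi | exists2 dw,
      graphical_derivative (normal_cone K) (g x) l ('d g x xi) dw
    & hessian (lagrangian l) x xi + adjoint ('d g x) dw = 0] = [set 0].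

(* The product of two inner product spaces carries the sum of the inner
   products, whose norm is not the max norm of the library on pairs. *)
Definition pair_norm (p : X * Y) : R := Num.sqrt (`|p.1| ^+ 2 + `|p.2| ^+ 2).

Definition strong_calmness (x : X) (l : Y) : Prop :=
  exists delta eps kappa : R, [/\ 0 < delta, 0 < eps, 0 < kappa
    & forall (a : X) (b : Y), pair_norm (a, b) <= delta ->
      forall (x' : X) (l' : Y), S_KKT a b (x', l') ->
        pair_norm (x' - x, l' - l) <= eps ->
        ((`|x' - x|)%:E + dist l' (multipliers x 0%R 0%R)
           <= (kappa * pair_norm (a, b))%:E)%E].

(* For the reduction map [Xi] of [K] at [g x] and the vector [mu] with
   [l = adjoint ('d Xi (g x)) mu]. *)
Definition Upsilon {Z : euclideanType R} (Xi : Y -> Z) (mu : Z) (y h : Y) : R :=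
  inner mu (diff2 Xi y h h).

Definition Sigma_set (ups : Y -> R) (x : X) (l : Y) : set (X * Y) :=
  [set p | hessian (lagrangian l) x p.1
           + adjoint ('d g x) (p.2 + 2^-1 *: gradient ups ('d g x p.1)) = 0].

Definition Gamma_tilde (x : X) (l : Y) : set (X * Y) :=
  [set p | critical_cone K (g x) l ('d g x p.1) /\
           exists n u, [/\ normal_cone K (g x) n, line l u
             & adjoint ('d g x) p.2 = adjoint ('d g x) (n + u)]].

End KKT.

(* Main.v *)
(* Blow-up argument. A sequence of perturbed KKT points violating the bound
   |x - xbar| <= C |(a, b)| yields, after division by t = |x - xbar|, a unit
   direction xi. Pulling the multipliers back to the cone D of the reduction,
   lambda = Xi'(y)^* m, splits (lambda - lbar) / t into a curvature part, which
   converges to the half gradient of Upsilon at h = g'(xbar) xi, and an element of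
   N - N, where N is the normal cone of K at g(xbar). A multiplier in ri N makes
   the image of N + R lbar under the adjoint of g'(xbar) the whole image of N - N,
   a subspace, hence closed: the limit comes from some zeta in N + R lbar. The sign
   condition and polarity give <h, zeta> = 0, and then zeta plus the curvature part
   is a graphical derivative of the normal cone mapping at h, because the path t h
   in D lifts through Xi by the Lyusternik-Graves theorem. So xi contradicts
   noncriticality. The bound for the multipliers is a Hoffman-type estimate, again
   based on the point of ri N. *)
Require Import Defs.
From HB Require Import structures.
From mathcomp Require Import all_boot all_order all_algebra.
From mathcomp Require Import all_classical all_reals all_analysis.
From mathcomp Require Import ring lra.

Set Implicit Arguments.
Unset Strict Implicit.
Unset Printing Implicit Defensive.

Import Order.TTheory GRing.Theory Num.Theory.
Import numFieldNormedType.Exports.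

Local Open Scope classical_set_scope.
Local Open Scope ring_scope.

(** * Euclidean spaces *)

(** The obstacle is that [(lambda - lbar) / t] need not stay bounded: other multipliers accumulate
    at [lbar]. Stationarity controls only its image under the adjoint of [g'(xbar)], so the limit is
    taken in the image and a preimage is chosen afterwards by a linear section.

    The splitting rests on the cone structure of [D]: a vector normal to [D] at one of its points is
    also normal at the vertex [Xi (g xbar) = 0]. Multipliers at nearby points are thus transported
    to normals of [K] at the fixed point [g xbar].

    The role of [ri N]: if [lh] is a multiplier in [ri N] and [z] lies in [N - N], then [lh + ep z]
    is in [N] for small [ep > 0]. As [lh] and [lbar] have the same image,
    [(lh + ep z) / ep - lbar / ep] is an element of [N + R lbar] with the image of [z]. *)

Lemma cvg_sum_seq (R : realType) (V : normedModType R) (I T : Type)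
    (F : set_system T) {FF : Filter F} (s : seq I) (f : I -> T -> V) (l : I -> V) :
  (forall i, f i @ F --> l i) ->
  (fun t => \sum_(i <- s) f i t) @ F --> \sum_(i <- s) l i.
Proof.
move=> fl; elim: s => [|i s IH].
  rewrite big_nil (_ : (fun _ => _) = (fun=> 0)); first exact: cvg_cst.
  by apply/funext => t; rewrite big_nil.
rewrite big_cons (_ : (fun _ => _) = (f i \+ fun t => \sum_(j <- s) f j t)).
  exact: cvgD.
by apply/funext => t; rewrite big_cons.
Qed.

Section InnerProduct.
Context {R : realType} {E : euclideanType R}.
Implicit Types x y z u v : E.

Lemma innerDr x y z : inner x (y + z) = inner x y + inner x z.
Proof. by rewrite innerC innerDl !(innerC x). Qed.

Lemma innerZr (a : R) x y : inner x (a *: y) = a * inner x y.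
Proof. by rewrite innerC innerZl (innerC x). Qed.

Lemma inner0l x : inner 0 x = 0.
Proof. by rewrite -(scale0r 0) innerZl mul0r. Qed.

Lemma inner0r x : inner x 0 = 0.
Proof. by rewrite innerC inner0l. Qed.

Lemma innerNl x y : inner (- x) y = - inner x y.
Proof. by rewrite -scaleN1r innerZl mulN1r. Qed.

Lemma innerNr x y : inner x (- y) = - inner x y.
Proof. by rewrite innerC innerNl innerC. Qed.

Lemma innerBl x y z : inner (x - y) z = inner x z - inner y z.
Proof. by rewrite innerDl innerNl. Qed.

Lemma innerBr x y z : inner x (y - z) = inner x y - inner x z.
Proof. by rewrite innerDr innerNr. Qed.

Lemma inner_suml (I : Type) (s : seq I) (F : I -> E) x :
  inner (\sum_(i <- s) F i) x = \sum_(i <- s) inner (F i) x.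
Proof.
by elim: s => [|i s IH]; rewrite ?big_nil ?inner0l// !big_cons innerDl IH.
Qed.

Lemma inner_sumr (I : Type) (s : seq I) (F : I -> E) x :
  inner x (\sum_(i <- s) F i) = \sum_(i <- s) inner x (F i).
Proof. by rewrite innerC inner_suml; apply: eq_bigr => i _; exact: innerC. Qed.

Lemma inner_inj x y : (forall v, inner x v = inner y v) -> x = y.
Proof.
move=> xy; apply/subr0_eq/eqP; rewrite -normr_eq0 -sqrf_eq0 -inner_norm.
by rewrite innerBl xy subrr.
Qed.

Lemma cauchy_schwarz x y : `|inner x y| <= `|x| * `|y|.
Proof.
have [->|y0] := eqVneq y 0; first by rewrite inner0r !normr0 mulr0.
have y2 : 0 < `|y| ^+ 2 by rewrite exprn_gt0// normr_gt0.
rewrite -(@ler_pXn2r _ 2)// ?nnegrE ?mulr_ge0//.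
have := sqr_ge0 (`| (`|y| ^+ 2) *: x - inner x y *: y|).
rewrite -inner_norm innerBl !innerBr !innerZl !innerZr (innerC y x) !inner_norm.
rewrite -normrX exprMn ger0_norm ?sqr_ge0// => h.
have {}h : 0 <= `|y| ^+ 2 * (`|x| ^+ 2 * `|y| ^+ 2 - inner x y ^+ 2).
  by apply: le_trans h _; rewrite le_eqVlt; apply/orP; left; apply/eqP; ring.
by rewrite -subr_ge0 -(pmulr_rge0 _ y2).
Qed.

Lemma inner_le x y : inner x y <= `|x| * `|y|.
Proof. exact: le_trans (ler_norm _) (cauchy_schwarz _ _). Qed.

Lemma cvg_inner (T : Type) (F : set_system T) {FF : Filter F}
    (f g : T -> E) x y :
  f @ F --> x -> g @ F --> y -> (fun t => inner (f t) (g t)) @ F --> inner x y.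
Proof.
move=> fx gy.
have dist0 (p : T -> E) q : p @ F --> q -> (fun t => `|p t - q|) @ F --> (0 : R).
  move=> pq; rewrite -(@normr0 _ E) -(subrr q).
  by apply: (cvg_norm (cvgB _ _)) => // => //; exact: cvg_cst.
have h : (fun t => `|f t - x| * `|g t| + `|x| * `|g t - y|) @ F --> (0 : R).
  rewrite (_ : 0 = 0 * `|y| + `|x| * 0 :> R); last by rewrite mul0r mulr0 addr0.
  apply: cvgD; apply: cvgM; try exact: cvg_cst; try exact: dist0.
  exact: cvg_norm.
apply/cvgrPdist_lt => e e0.
move/cvgrPdist_lt : h => /(_ _ e0); apply: filterS => t.
rewrite sub0r normrN ger0_norm ?addr_ge0 ?mulr_ge0// => /le_lt_trans; apply.
rewrite distrC (_ : _ - _ = inner (f t - x) (g t) + inner x (g t - y)).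
  by rewrite (le_trans (ler_normD _ _))// lerD// cauchy_schwarz.
by rewrite innerBl innerBr; ring.
Qed.

Let inner_linear x : linear (inner x : E -> R).
Proof. by move=> a u v; rewrite innerDr innerZr. Qed.

Definition inner_form x : {linear E -> R} :=
  HB.pack (inner x : E -> R) (GRing.isLinear.Build _ _ _ _ _ (inner_linear x)).

End InnerProduct.

Section Frame.
Context {R : realType} {E : euclideanType R}.
Implicit Types (x v : E) (e : seq E).

Let coords e x : E := \sum_(u <- e) inner x u *: u.

Let coordsP a x y e : coords e (a *: x + y) = a *: coords e x + coords e y.
Proof.
rewrite /coords scaler_sumr -big_split/=; apply: eq_bigr => u _.
by rewrite innerDl innerZl scalerDl scalerA.
Qed.

Let coords_self_adjoint e x y : inner (coords e x) y = inner x (coords e y).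
Proof.
rewrite inner_suml inner_sumr; apply: eq_bigr => u _.
by rewrite innerZl innerZr (innerC u) mulrC.
Qed.

(* Gram-Schmidt. An invariant weaker than orthonormality suffices: the
   self-adjoint map [coords e] fixes every element of [e]. *)
Let frame_of_seq (s : seq E) :
  exists e, (forall u, u \in e -> coords e u = u) /\
            (forall v, v \in s -> coords e v = v).
Proof.
elim: s => [|v s [e [ee es]]]; first by exists [::].
pose r := v - coords e v.
have [r0|rN0] := eqVneq r 0.
  exists e; split=> // w; rewrite inE => /predU1P[->|]; last exact: es.
  by apply/esym/subr0_eq.
have nr : `|r| != 0 by rewrite normr_eq0.
have re u : u \in e -> inner r u = 0.
  by move=> ue; rewrite innerBl coords_self_adjoint ee// subrr.
pose w := `|r|^-1 *: r.
have we u : u \in e -> inner w u = 0 by move=> ue; rewrite innerZl re// mulr0.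
have coords_w : coords e w = 0.
  by rewrite /coords big_seq big1// => u ue; rewrite we// scale0r.
have fixw x : coords e x = x -> coords (w :: e) x = x.
  move=> ex; rewrite /coords big_cons -/(coords e x) -{1}ex.
  by rewrite coords_self_adjoint coords_w inner0r scale0r add0r.
have ww : inner w w = 1.
  by rewrite /w innerZl innerZr inner_norm expr2 mulKf// mulVf.
have vw : inner v w = `|r|.
  have -> : v = r + coords e v by rewrite subrK.
  rewrite innerDl coords_self_adjoint coords_w inner0r addr0 /w innerZr.
  by rewrite inner_norm expr2 mulKf.
exists (w :: e); split=> u; rewrite inE => /predU1P[->|uS].
- by rewrite /coords big_cons -/(coords e w) coords_w addr0 ww scale1r.
- exact/fixw/ee.
- rewrite /coords big_cons -/(coords e v) vw /w scalerA mulfV// scale1r.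
  by rewrite subrK.
- exact/fixw/es.
Qed.

Lemma frame_ex : exists e, forall x, x = \sum_(u <- e) inner x u *: u.
Proof.
have [e [_ ev]] := frame_of_seq (vbasis (fullv : {vspace E})).
exists e => x; rewrite -/(coords e x).
rewrite (coord_vbasis (memvf x)).
elim/big_rec: _ => [|i y _ IH]; first by rewrite /coords big1// => u _; rewrite inner0l scale0r.
by rewrite coordsP -IH ev// mem_nth// size_tuple.
Qed.

(** A Parseval frame: known only through [frameE], it stands in for an orthonormal basis in all
    coordinate computations. *)
Definition frame : seq E := sval (cid frame_ex).

Lemma frameE x : x = \sum_(u <- frame) inner x u *: u.
Proof. exact: (svalP (cid frame_ex)). Qed.

End Frame.

Section LinearMaps.
Context {R : realType}.

Lemma linear_bounded (E : euclideanType R) (F : normedModType R)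
    (A : {linear E -> F}) : exists2 C : R, 0 < C & forall x, `|A x| <= C * `|x|.
Proof.
exists (1 + \sum_(u <- @frame R E) `|u| * `|A u|).
  by rewrite ltr_pwDl// sumr_ge0// => u _; rewrite mulr_ge0.
move=> x; rewrite {1}(frameE x) linear_sum (le_trans (ler_norm_sum _ _ _))//.
rewrite mulrDl mul1r ler_wpDl// mulr_suml ler_sum// => u _.
rewrite linearZ normrZ mulrAC ler_wpM2r// mulrC.
exact: cauchy_schwarz.
Qed.

Lemma linear_continuous (E : euclideanType R) (F : normedModType R)
    (A : {linear E -> F}) : continuous A.
Proof.
have [C C0 AC] := linear_bounded A.
apply/linear_bounded_continuous/linear_boundedP; exists C; split => //.
  exact: num_real.
by move=> M CM x; apply: le_trans (AC x) _; rewrite ler_wpM2r// ltW.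
Qed.

(** The frame supplies an explicit representative, the sum of [phi u *: u], so for a linear [phi]
    the choice in [riesz] never falls back on its default value. *)
Lemma rieszP (E : euclideanType R) (phi : {linear E -> R}) x :
  inner (riesz phi) x = phi x.
Proof.
rewrite /riesz; case: xgetP => [v _ ->//|/(_ (\sum_(u <- @frame R E) phi u *: u))].
case=> y; rewrite inner_suml [in RHS](frameE y) linear_sum.
by apply: eq_bigr => u _; rewrite innerZl linearZ/= innerC mulrC.
Qed.

Section Adjoint.
Context {E F : euclideanType R}.

Lemma adjointP (A : {linear E -> F}) y x : inner (adjoint A y) x = inner y (A x).
Proof.
exact: (rieszP (inner_form y \o A)).
Qed.

Lemma adjoint_linear (A : {linear E -> F}) : linear (adjoint A).
Proof.
move=> a y z; apply: inner_inj => v.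
by rewrite innerDl innerZl !adjointP innerDl innerZl.
Qed.

Definition adjoint_lin (A : {linear E -> F}) : {linear F -> E} :=
  HB.pack (adjoint A : F -> E) (GRing.isLinear.Build _ _ _ _ _ (adjoint_linear A)).

Lemma adjointE (A : {linear E -> F}) y :
  adjoint A y = \sum_(u <- frame) inner y (A u) *: u.
Proof. by rewrite {1}(frameE (adjoint A y)); apply: eq_bigr => u _; rewrite adjointP. Qed.

Lemma adjointD (A : {linear E -> F}) y z : adjoint A (y + z) = adjoint A y + adjoint A z.
Proof. exact: (linearD (adjoint_lin A)). Qed.

Lemma adjointB (A : {linear E -> F}) y z : adjoint A (y - z) = adjoint A y - adjoint A z.
Proof. exact: (linearB (adjoint_lin A)). Qed.

Lemma adjointZ (A : {linear E -> F}) a y : adjoint A (a *: y) = a *: adjoint A y.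
Proof. exact: (linearZZ (adjoint_lin A)). Qed.

End Adjoint.
End LinearMaps.

Section Compactness.
Context {R : realType} {E : euclideanType R}.

(** The ball is a closed subset of the image of a cube under the continuous map [c], which need not
    be injective. [M] dominates the norm of every frame vector, so by Cauchy-Schwarz the frame
    coefficients of [x - x0] lie in the cube. *)
Lemma closed_ball_compact (x0 : E) (r : R) : compact [set x | `|x - x0| <= r].
Proof.
pose e := @frame R E; pose n := size e.
pose c (v : 'rV[R]_n) : E := x0 + \sum_(i < n) v ord0 i *: e`_i.
pose M := \sum_(u <- e) `|u|.
pose Q := [set v : 'rV[R]_n | forall i, `[- (M * r), M * r]%classic (v ord0 i)].
have Qc : compact Q.
  apply: (@rV_compact _ _ (fun=> `[- (M * r), M * r]%classic)) => i.
  exact: segment_compact.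
have c_cont : continuous c.
  move=> v; have Fv : Filter (nbhs v) by exact: nbhs_filter.
  rewrite /continuous_at /c; apply: (cvgD (cvg_cst x0)).
  apply: (@cvg_sum_seq _ _ _ _ (nbhs v) Fv) => i.
  by apply: (@cvgZr_tmp _ _ _ (nbhs v) Fv); exact: coord_continuous.
have cQ : compact (c @` Q).
  by apply: continuous_compact => //; exact: continuous_subspaceT.
apply: (subclosed_compact _ cQ).
  apply: (@closed_comp _ _ (fun x : E => `|x - x0|) [set y | y <= r]).
    move=> x _; apply: cvg_norm; apply: cvgB; [exact: cvg_id|exact: cvg_cst].
  exact: closed_le.
move=> x /= xr.
exists (\row_(i < n) inner (x - x0) e`_i).
  move=> i /=; rewrite mxE in_itv/= -ler_norml.
  apply: le_trans (cauchy_schwarz _ _) _; rewrite mulrC ler_pM//.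
  rewrite /M (big_nth 0) big_mkord (bigD1 i)//= lerDl.
  by rewrite sumr_ge0.
rewrite /c -[RHS](subrKC x0) [in RHS](frameE (x - x0)); congr (_ + _).
rewrite -/e [RHS](big_nth 0) big_mkord.
by apply: eq_bigr => i _; rewrite mxE.
Qed.

End Compactness.

(** * Differential calculus *)

Section FirstOrder.
Context {R : realType}.

Lemma nbhs_norm_lt (E : normedModType R) (x : E) (P : set E) :
  nbhs x P <-> exists2 r : R, 0 < r & forall z, `|z - x| < r -> P z.
Proof.
rewrite nbhs_ballP; split=> -[r /= r0 rP]; exists r => // z zx; apply: rP.
  by rewrite -ball_normE /= distrC.
by move: zx; rewrite -ball_normE /= distrC.
Qed.

Lemma differentiable_littleo (E F : normedModType R) (f : E -> F) x :
  differentiable f x -> forall e : R, 0 < e -> exists2 r : R, 0 < r &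
  forall h, `|h| < r -> `|f (x + h) - f x - 'd f x h| <= e * `|h|.
Proof.
move=> /diff_locally/eqaddoP df e e0.
have /nbhs_norm_lt[r r0 rP] := df _ e0; exists r => // h hr.
have := rP h; rewrite subr0 => /(_ hr).
by rewrite -[(_ - _) h]/(f (h + x) - (f x + 'd f x h)) opprD addrA [h + x]addrC.
Qed.

Lemma littleo_differentiable (E : euclideanType R) (F : normedModType R)
    (f : E -> F) x (L : {linear E -> F}) :
  (forall e : R, 0 < e -> exists2 r : R, 0 < r &
    forall h, `|h| < r -> `|f (x + h) - f x - L h| <= e * `|h|) ->
  is_diff x f L.
Proof.
move=> fL; have Lc := @linear_continuous _ _ _ L.
have fLo : f \o shift x = cst (f x) + (L : E -> F) +o_ 0 id.
  apply/eqaddoP => e e0; have [r r0 rP] := fL _ e0.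
  apply/nbhs_norm_lt; exists r => // h; rewrite subr0 => /rP.
  by rewrite -[(_ - _) h]/(f (h + x) - (f x + L h)) opprD addrA [h + x]addrC.
have dL := diff_unique Lc fLo.
by apply: DiffDef => //; apply/diff_locallyP; rewrite dL.
Qed.

Lemma differentiable_calm (E : euclideanType R) (F : normedModType R)
    (f : E -> F) x :
  differentiable f x -> exists C r : R, [/\ 0 < C, 0 < r &
  forall z, `|z - x| < r -> `|f z - f x| <= C * `|z - x|].
Proof.
move=> /differentiable_littleo/(_ _ ltr01)[r r0 rP].
have [C C0 LC] := linear_bounded ('d f x).
exists (1 + C), r; split=> [||z zr]; rewrite ?addr_gt0//.
have {rP} := rP _ zr; rewrite subrKC => h.
rewrite -(subrK ('d f x (z - x)) (_ - f x)) (le_trans (ler_normD _ _))//.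
by rewrite mulrDl lerD.
Qed.

(** Hadamard form: the directions vary with [k], as contingent cones require. They are eventually
    bounded by [|v| + 1], so the remainder is [o(t k)]. *)
Lemma cvg_difference_quotient (E : euclideanType R) (F : normedModType R)
    (f : E -> F) x (T : Type) (G : set_system T) {FG : Filter G}
    (t : T -> R) (d : T -> E) v :
  differentiable f x -> (forall k, 0 < t k) -> t @ G --> (0 : R) ->
  d @ G --> v ->
  (fun k => (t k)^-1 *: (f (x + t k *: d k) - f x)) @ G --> 'd f x v.
Proof.
move=> df t0 tG dG.
have td0 : (fun k => t k *: d k) @ G --> (0 : E).
  by rewrite -(scale0r v); exact: cvgZ.
have Ldv : (fun k => 'd f x (d k)) @ G --> 'd f x v.
  by apply: continuous_cvg => //; exact: linear_continuous.
rewrite -[X in _ --> X]add0r.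
rewrite (_ : (fun k => _) =
  (fun k => (t k)^-1 *: (f (x + t k *: d k) - f x) - 'd f x (d k)) \+
  (fun k => 'd f x (d k))); last by apply/funext => k /=; rewrite subrK.
apply: cvgD => //; apply/cvgrPdist_le => e e0.
have M0 : 0 < `|v| + 1 by rewrite ltr_wpDl.
have [r r0 rP] := differentiable_littleo df (divr_gt0 e0 M0).
have small : \forall k \near G, `|t k *: d k| < r.
  by move/cvgrPdist_lt : td0 => /(_ _ r0); apply: filterS => k; rewrite sub0r normrN.
have bnd : \forall k \near G, `|d k| < `|v| + 1.
  move/cvgrPdist_lt : dG => /(_ _ ltr01); apply: filterS => k vd.
  rewrite -(subrK v (d k)) (le_lt_trans (ler_normD _ _))// addrC.
  by rewrite ltrD2l distrC.
apply: filterS2 small bnd => k /rP h kM; rewrite sub0r normrN.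
have -> : (t k)^-1 *: (f (x + t k *: d k) - f x) - 'd f x (d k) =
    (t k)^-1 *: (f (x + t k *: d k) - f x - 'd f x (t k *: d k)).
  by rewrite linearZ/= [in RHS]scalerBr scalerA mulVf ?scale1r// gt_eqF.
rewrite normrZ normfV gtr0_norm// ler_pdivrMl//.
apply: le_trans h _; rewrite normrZ gtr0_norm// mulrCA ler_wpM2l// ?(ltW (t0 k))//.
by rewrite mulrAC ler_pdivrMr// ler_pM2l// ltW.
Qed.

(** Scalarization by the defect [d] itself: the mean value theorem for [rho] gives
    [|d|^2 = <d, 'd f (x + s w) w - c>] for some [s], and Cauchy-Schwarz cancels one factor [|d|].
    The constant [c] allows the bound to measure linearization errors. *)
Lemma mean_value_ineq (E F : euclideanType R) (f : E -> F) x w c (C : R) :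
  (forall s : R, 0 <= s <= 1 -> differentiable f (x + s *: w) /\
    `|'d f (x + s *: w) w - c| <= C) ->
  `|f (x + w) - f x - c| <= C.
Proof.
move=> fC; set d := f (x + w) - f x - c.
have [->|dN0] := eqVneq d 0.
  by rewrite normr0; have [] := fC 0; rewrite ?lexx ?ler01// => _ /(le_trans _); apply.
pose L := inner_form d.
pose p (s : R) : E := x + s *: w.
pose rho (s : R) : R := L (f (p s)) - s * L c.
pose drho (s : R) : R := L ('d f (p s) w - c).
have drhoP (s : R) : 0 <= s <= 1 -> is_derive s 1 rho (drho s).
  move=> /fC[df _].
  have dp : is_diff s p ( *:%R^~ w).
    apply: is_diff_eq (is_diffD (is_diff_cst x s) (is_diff_scalel s w)) _.
    by rewrite add0r.
  have dfp := is_diff_comp dp (differentiableP df).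
  have dL : is_diff ((f \o p) s) L L.
    have Lc := @linear_continuous _ _ _ L.
    by apply: DiffDef; [exact: linear_differentiable|rewrite diff_lin].
  have drho' := is_diffB (is_diff_comp dfp dL) (is_diff_scalel s (L c)).
  apply: DeriveDef; first exact/diff_derivable/ex_diff.
  rewrite deriveE; last exact: ex_diff.
  rewrite (@diff_val _ _ _ _ _ _ _ drho') /drho linearB/=.
  rewrite -[LHS]/(L ('d f (x + s *: w) (1 *: w)) - 1 *: L c).
  by rewrite !scale1r.
have [||s s01] := @MVT_segment R rho drho 0 1 ler01.
- by move=> s /[!in_itv]/= /andP[s0 s1]; apply: drhoP; rewrite !ltW.
- apply: derivable_within_continuous => s /[!in_itv]/= s01.
  by have [] := drhoP s s01.
rewrite in_itv/= in s01 *.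
rewrite subr0 mulr1 /rho /drho /p scale1r scale0r addr0 mul1r mul0r subr0 => e.
have {e} : inner d d = inner d ('d f (x + s *: w) w - c).
  by rewrite -[RHS]/(L _) -e {2}/d !innerBr/L/=; ring.
rewrite inner_norm expr2 => e.
have [_ /(le_trans _) h] := fC s s01.
rewrite -(@ler_pM2l _ `|d|) ?normr_gt0// e.
by apply: le_trans (inner_le _ _) _; rewrite ler_wpM2l//; apply: h.
Qed.
End FirstOrder.

Lemma subrACA (V : zmodType) (a b c d : V) : a - b - (c - d) = a - c - (b - d).
Proof. by rewrite !opprD !opprK addrACA. Qed.

(** * Second derivatives and the curvature term *)

Section SecondOrder.
Context {R : realType} {E F : euclideanType R}.
Variables (Xi : E -> F) (y : E).
Hypothesis dXi : \forall z \near y, differentiable Xi z.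
Hypothesis ddXi : forall v, differentiable (fun z => 'd Xi z v) y.

(** The hypothesis controls the derivative one vector at a time; applied to the finitely many frame
    vectors and summed, it gives a bound uniform in the direction [w]. *)
Lemma diff_calm : exists C r : R, [/\ 0 < C, 0 < r &
  forall z, `|z - y| < r ->
    forall w, `|'d Xi z w - 'd Xi y w| <= C * `|z - y| * `|w|].
Proof.
have calm_on (s : seq E) : exists C r : R, [/\ 0 < C, 0 < r &
    forall z, `|z - y| < r ->
    forall u, u \in s -> `|'d Xi z u - 'd Xi y u| <= C * `|z - y|].
  elim: s => [|v s [C [r [C0 r0 Cr]]]]; first by exists 1, 1; split.
  have [C' [r' [C'0 r'0 Cr']]] := differentiable_calm (ddXi v).
  exists (C + C'), (Num.min r r'); split; rewrite ?addr_gt0 ?lt_min ?r0//.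
  move=> z; rewrite lt_min => /andP[zr zr'] u; rewrite inE => /predU1P[->|us].
    by apply: le_trans (Cr' z zr') _; rewrite ler_wpM2r// lerDr ltW.
  by apply: le_trans (Cr z zr _ us) _; rewrite ler_wpM2r// lerDl ltW.
have [C [r [C0 r0 Cr]]] := calm_on frame; set s := frame in Cr *.
exists (1 + C * \sum_(u <- s) `|u|), r; split => //.
  by rewrite ltr_pwDl// mulr_ge0 ?sumr_ge0// ltW.
move=> z zr w; rewrite {1 2}(frameE w) (linear_sum ('d Xi z)) (linear_sum ('d Xi y)) -sumrB -/s.
rewrite (le_trans (ler_norm_sum _ _ _))// mulrDl mul1r mulrDl ler_wpDl//.
rewrite -!mulrA mulr_suml mulr_sumr [leLHS]big_seq [leRHS]big_seq ler_sum// => u us.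
rewrite (linearZZ ('d Xi z)) (linearZZ ('d Xi y)) -scalerBr normrZ.
have -> : C * (`|u| * (`|z - y| * `|w|)) = (`|w| * `|u|) * (C * `|z - y|) by ring.
by rewrite ler_pM// ?cauchy_schwarz// Cr.
Qed.

Lemma strict_differentiability (e : R) : 0 < e -> exists2 r : R, 0 < r &
  forall u v, `|u - y| < r -> `|v - y| < r ->
    `|Xi u - Xi v - 'd Xi y (u - v)| <= e * `|u - v|.
Proof.
move=> e0; have [C [r [C0 r0 Cr]]] := diff_calm.
have /nbhs_norm_lt[r' r'0 dXir'] := dXi.
exists (Num.min (Num.min r r') (e / C)).
  by rewrite !lt_min r0 r'0 divr_gt0.
move=> u v; rewrite !lt_min => /andP[/andP[ur ur'] ue] /andP[/andP[vr vr'] ve].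
rewrite -{1}[u](subrKC v); apply: mean_value_ineq => s /andP[s0 s1].
have ball_s q : `|u - y| < q -> `|v - y| < q -> `|v + s *: (u - v) - y| < q.
  move=> uq vq.
  have -> : v + s *: (u - v) - y = s *: (u - y) + (1 - s) *: (v - y).
    by rewrite scalerBl scale1r addrCA -scalerBr opprB addrA subrK addrAC.
  rewrite (le_lt_trans (ler_normD _ _))// !normrZ (ger0_norm s0).
  rewrite ger0_norm ?subr_ge0//.
  have [->|sN0] := eqVneq s 0; first by rewrite mul0r add0r subr0 mul1r.
  have -> : q = s * q + (1 - s) * q by ring.
  apply: ltr_leD; first by rewrite ltr_pM2l// lt_neqAle eq_sym sN0.
  by rewrite ler_wpM2l ?subr_ge0// ltW.
split; first exact/dXir'/ball_s.
rewrite (le_trans (Cr _ (ball_s _ ur vr) _))// ler_wpM2r//.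
by rewrite mulrC -ler_pdivlMr// ltW// ball_s.
Qed.

Lemma diff2_linear u : linear (diff2 Xi y u).
Proof.
move=> a v w; rewrite /diff2.
have dvw := is_diffD (is_diffZ a (differentiableP (ddXi v)))
  (differentiableP (ddXi w)).
rewrite (_ : (fun z => 'd Xi z (a *: v + w)) =
   a *: (fun z => 'd Xi z v) + (fun z => 'd Xi z w)).
  by rewrite (@diff_val _ _ _ _ _ _ _ dvw).
by apply/funext => z; rewrite linearP.
Qed.

(** The second difference is the increment along [t u] of [f z = Xi (z + t v) - Xi z], to which the
    mean value inequality applies. Linearizing [z |-> 'd Xi z u] at [y] costs [e t (|u| + |v|)] at
    the shifted point and [e t |u|] at the other one. *)
Lemma second_difference u v (e : R) : 0 < e -> exists2 r : R, 0 < r &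
  forall t, 0 < t < r ->
    `|Xi (y + t *: u + t *: v) - Xi (y + t *: u) - (Xi (y + t *: v) - Xi y)
      - t ^+ 2 *: diff2 Xi y v u| <= t ^+ 2 * (e * (`|u| + `|u| + `|v|)).
Proof.
move=> e0; have [r r0 rP] := differentiable_littleo (ddXi u) e0.
have /nbhs_norm_lt[r' r'0 dXir'] := dXi.
pose M := `|u| + `|v| + 1; have M0 : 0 < M by rewrite ltr_wpDl// addr_ge0.
exists (Num.min r r' / M); first by rewrite divr_gt0// lt_min r0.
move=> t /andP[t0]; rewrite ltr_pdivlMr// lt_min => /andP[tr tr'].
pose f z := Xi (z + t *: v) - Xi z.
have -> : Xi (y + t *: u + t *: v) - Xi (y + t *: u) - (Xi (y + t *: v) - Xi y)
  = f (y + t *: u) - f y by [].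
apply: mean_value_ineq => s /andP[s0 s1]; set z := y + s *: (t *: u).
have nz : `|s *: (t *: u)| <= t * `|u|.
  rewrite !normrZ (ger0_norm s0) (gtr0_norm t0) ler_piMl//.
  by rewrite mulr_ge0// ltW.
have nzv : `|s *: (t *: u) + t *: v| <= t * (`|u| + `|v|).
  by rewrite (le_trans (ler_normD _ _))// mulrDr lerD// normrZ gtr0_norm.
have lt1 : t * `|u| < t * M by rewrite ltr_pM2l// /M -addrA ltrDl ltr_wpDl.
have lt2 : t * (`|u| + `|v|) < t * M by rewrite ltr_pM2l// /M ltrDl.
have dz : differentiable Xi z.
  by apply: dXir'; rewrite /z addrAC subrr add0r (le_lt_trans nz)// (lt_trans lt1).
have dzv : differentiable Xi (z + t *: v).
  apply: dXir'; rewrite /z -[y + _ + _]addrA addrAC subrr add0r.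
  by rewrite (le_lt_trans nzv)// (lt_trans lt2).
have df : is_diff z f (fun w => 'd Xi (z + t *: v) w - 'd Xi z w).
  have dshift : is_diff z (fun z => z + t *: v) id.
    by apply: is_diff_eq (is_diffD (is_diff_id z) (is_diff_cst (t *: v) z)) _; rewrite addr0.
  exact: (is_diffB (is_diff_comp dshift (differentiableP dzv)) (differentiableP dz)).
split; first exact: ex_diff.
rewrite (@diff_val _ _ _ _ _ _ _ df).
rewrite (linearZZ ('d Xi (z + t *: v))) (linearZZ ('d Xi z)) expr2 -scalerA.
rewrite -!scalerBr normrZ gtr0_norm// -mulrA ler_pM2l//.
set D := 'd (fun z => 'd Xi z u) y in rP.
have Dv : t *: diff2 Xi y v u = D (s *: (t *: u) + t *: v) - D (s *: (t *: u)).
  by rewrite linearD addrAC subrr add0r linearZ.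
pose err h := 'd Xi (y + h) u - 'd Xi y u - D h.
have -> : 'd Xi (z + t *: v) u - 'd Xi z u - t *: diff2 Xi y v u =
    err (s *: (t *: u) + t *: v) - err (s *: (t *: u)).
  by rewrite Dv /err [RHS]subrACA; congr (_ - _); rewrite opprB addrA subrK /z addrA.
have err_le h (b : R) : `|h| <= t * b -> t * b < t * M -> `|err h| <= e * (t * b).
  move=> hb bM; apply: le_trans (rP h _) _; last by rewrite ler_wpM2l// ltW.
  by rewrite (le_lt_trans hb)// (lt_trans bM).
rewrite (le_trans (ler_normB _ _))//.
have -> : t * (e * (`|u| + `|u| + `|v|)) =
  e * (t * (`|u| + `|v|)) + e * (t * `|u|) by ring.
by rewrite lerD// err_le.
Qed.

(** The second difference is unchanged when [u] and [v] are exchanged, and [t^2] times either mixed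
    derivative approximates it. [M] collects the coefficients of both errors. *)
Lemma diff2_sym u v : diff2 Xi y u v = diff2 Xi y v u.
Proof.
apply/subr0_eq/eqP; rewrite -normr_le0; apply/ler_addgt0Pr => e e0; rewrite add0r.
pose M := `|u| + `|u| + `|v| + (`|v| + `|v| + `|u|) + 1.
have M0 : 0 < M by rewrite ltr_wpDl// !addr_ge0.
have [r r0 rP] := second_difference u v (divr_gt0 e0 M0).
have [r' r'0 rP'] := second_difference v u (divr_gt0 e0 M0).
pose t := Num.min r r' / 2; have t0 : 0 < t by rewrite divr_gt0// lt_min r0.
have /andP[tr tr'] : (t < r) && (t < r').
  by rewrite -lt_min /t gtr_pMr ?lt_min ?r0// invf_lt1// ltr1n.
have {rP} := rP t; rewrite t0 tr => /(_ isT) h1.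
have {rP'} := rP' t; rewrite t0 tr' => /(_ isT) h2.
have t2 : 0 < t ^+ 2 by rewrite exprn_gt0.
rewrite -(ler_pM2l t2) -{1}(gtr0_norm t2) -normrZ.
set d := Xi (y + t *: u + t *: v) - Xi (y + t *: u) - (Xi (y + t *: v) - Xi y) in h1.
rewrite subrACA (addrAC y (t *: v)) -/d in h2.
have -> : t ^+ 2 *: (diff2 Xi y u v - diff2 Xi y v u) =
  (d - t ^+ 2 *: diff2 Xi y v u) - (d - t ^+ 2 *: diff2 Xi y u v).
  by rewrite scalerBr subrACA subrr sub0r opprB.
rewrite (le_trans (ler_normB _ _))// (le_trans (lerD h1 h2))//.
rewrite -mulrDr ler_pM2l// -mulrDr mulrAC ler_pdivrMr// ler_pM2l// /M.
by rewrite lerDl.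
Qed.

(** [Upsilon] is the quadratic form of [Q], symmetric by [diff2_sym]: its increment at [h] is
    [2 * Q h v] plus [Q v v], which is at most [M |v|^2]. The factor [2] cancels, and the frame
    expansion of the form [Q h] remains. *)
Lemma gradient_Upsilon mu h :
  2^-1 *: gradient (Upsilon Xi mu y) h =
  \sum_(u <- frame) inner mu (diff2 Xi y h u) *: u.
Proof.
pose Q u v := inner mu (diff2 Xi y u v).
have Q_linear u : linear (Q u).
  by move=> a v w; rewrite /Q diff2_linear innerDr innerZr.
pose Ql u : {linear E -> R} := HB.pack (Q u) (GRing.isLinear.Build _ _ _ _ _ (Q_linear u)).
have QC u v : Q u v = Q v u by rewrite /Q diff2_sym.
have QD u v w : Q u (v + w) = Q u v + Q u w by exact: (linearD (Ql u)).
pose G u := \sum_(v <- frame) Q u v *: v.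
have GE u v : inner (G u) v = Q u v.
  rewrite inner_suml -[RHS]/(Ql u v) [in RHS](frameE v) linear_sum.
  by apply: eq_bigr => w _; rewrite (linearZZ (Ql u)) innerZl innerC mulrC.
have G_linear : linear G.
  move=> a u v; apply: inner_inj => w; rewrite innerDl innerZl !GE !(QC _ w).
  exact: (linearP (Ql w)).
pose Gl : {linear E -> E} := HB.pack G (GRing.isLinear.Build _ _ _ _ _ G_linear).
have [M M0 GM] := linear_bounded Gl.
pose L : {linear E -> R} := 2 \*: Ql h.
have dU : is_diff h (Upsilon Xi mu y) L.
  apply: littleo_differentiable => e e0.
  exists (e / M); first by rewrite divr_gt0.
  move=> v; rewrite ltr_pdivlMr// => ve.
  have -> : Upsilon Xi mu y (h + v) - Upsilon Xi mu y h - L v = Q v v.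
    rewrite -[Upsilon _ _ _ _]/(Q (h + v) (h + v)) -[Upsilon _ _ _ _]/(Q h h).
    rewrite -[L v]/(2 * Q h v).
    rewrite (QD (h + v) h v) (QC (h + v) h) (QC (h + v) v) (QD h h v) (QD v h v).
    by rewrite (QC v h); move: (Q h h) (Q h v) (Q v v) => p q r; ring.
  rewrite -GE (le_trans (cauchy_schwarz _ _))// ler_wpM2r//.
  by rewrite (le_trans (GM v))// ltW// mulrC.
rewrite -/(G h); apply: inner_inj => v; rewrite innerZl GE rieszP.
by rewrite (@diff_val _ _ _ _ _ _ _ dU) -[L v]/(2 * Q h v) mulKf.
Qed.

(** In frame coordinates the quotient is the inner product of [m k] with a difference quotient of
    [z |-> 'd Xi z u], which tends to [diff2 Xi y h u]. The vector [m k] may move as well, as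
    multipliers do. *)
Lemma cvg_adjoint_quotient (T : Type) (G : set_system T) {FG : Filter G}
    (t : T -> R) (d : T -> E) h (m : T -> F) mu :
  (forall k, 0 < t k) -> t @ G --> (0 : R) -> d @ G --> h -> m @ G --> mu ->
  (fun k => (t k)^-1 *: (adjoint ('d Xi (y + t k *: d k)) (m k)
                         - adjoint ('d Xi y) (m k)))
    @ G --> 2^-1 *: gradient (Upsilon Xi mu y) h.
Proof.
move=> t0 tG dG mG; rewrite gradient_Upsilon.
rewrite (_ : (fun _ => _) = (fun k => \sum_(u <- frame)
   inner (m k) ((t k)^-1 *: ('d Xi (y + t k *: d k) u - 'd Xi y u)) *: u)).
  apply: cvg_sum_seq => u; apply: cvgZr_tmp; apply: cvg_inner => //.
  exact: cvg_difference_quotient.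
apply/funext => k; rewrite !adjointE -sumrB scaler_sumr.
by apply: eq_bigr => u _; rewrite -scalerBl -innerBr scalerA innerZr.
Qed.

Lemma adjoint_calm : exists C r : R, [/\ 0 < C, 0 < r &
  forall z, `|z - y| < r -> forall mu,
    `|adjoint ('d Xi z) mu - adjoint ('d Xi y) mu| <= C * `|z - y| * `|mu|].
Proof.
have [C [r [C0 r0 Cr]]] := diff_calm.
exists C, r; split=> // z zr mu.
set v := adjoint _ _ - _.
have [->|vN0] := eqVneq v 0; first by rewrite normr0 mulr_ge0// mulr_ge0// ltW.
rewrite -(@ler_pM2r _ `|v|) ?normr_gt0// -expr2 -inner_norm {1}/v innerBl.
rewrite !adjointP -innerBr (le_trans (inner_le _ _))// mulrAC mulrC.
by rewrite ler_wpM2r// Cr.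
Qed.

End SecondOrder.

(** * Metric regularity *)

Section MetricRegularity.
Context {R : realType} {E F : euclideanType R}.

Lemma linear_section (B : {linear E -> F}) :
  range B = setT -> exists P : {linear F -> E}, forall z, B (P z) = z.
Proof.
move=> BT; exists ((linfun B)^-1)%VF => z.
rewrite -(lfunE B) limg_lfunVK//.
have [x _ <-] : range B z by rewrite BT.
by rewrite -(lfunE B) memv_img// memvf.
Qed.

(* Lyusternik-Graves. Where the penalized residual [|f u - z| + |u - u0| / 4p] is
   minimal the residual vanishes: otherwise the direction [P (z - f u)] would
   decrease it, [p] being a bound for the right inverse [P] of [B]. *)
Lemma metric_regularity (f : E -> F) y (B : {linear E -> F})
    (P : {linear F -> E}) (p r : R) :
  (forall z, B (P z) = z) -> 0 < p -> (forall z, `|P z| <= p * `|z|) -> 0 < r ->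
  (forall u v, `|u - y| < r -> `|v - y| < r ->
     `|f u - f v - B (u - v)| <= (4 * p)^-1 * `|u - v|) ->
  forall u0 z, `|u0 - y| < r / 2 -> `|f u0 - z| <= (4 * p)^-1 * (r / 4) ->
  exists u, f u = z /\ `|u - u0| <= 4 * p * `|f u0 - z|.
Proof.
move=> BP p0 Pp r0 fB u0 z u0r fu0.
have k0 : 0 < (4 * p)^-1 by rewrite invr_gt0 mulr_gt0.
(* The radius [r / 3] keeps [A] within distance [r] of [y], as [r / 2 + r / 3 < r]. It exceeds by
   [r / 12] the bound [r / 4] for the distance of the minimizer to [u0], which leaves room for a
   step of length at most [r / 12]. *)
pose A := [set u : E | `|u - u0| <= r / 3].
have Ar u : A u -> `|u - y| < r.
  rewrite /A/= => ur; rewrite -(subrK u0 u) -addrA.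
  by rewrite (le_lt_trans (ler_normD _ _))//; lra.
pose psi u := `|f u - z| + (4 * p)^-1 * `|u - u0|.
have Au0 : A u0 by rewrite /A/= subrr normr0 divr_ge0// ltW.
have f_cont u : A u -> {for u, continuous f}.
  move=> /Ar ur; have [C C0 BC] := linear_bounded B.
  have K0 : 0 < (4 * p)^-1 + C by rewrite addr_gt0.
  apply/cvgrPdist_le => e e0.
  apply/nbhs_norm_lt; exists (Num.min (r - `|u - y|) (e / ((4 * p)^-1 + C))).
    by rewrite lt_min subr_gt0 ur divr_gt0.
  move=> v; rewrite lt_min => /andP[vr ve].
  have {}vr : `|v - y| < r.
    by rewrite -(subrK u v) -addrA (le_lt_trans (ler_normD _ _))// -ltrBrDr.
  rewrite distrC -(subrK (B (v - u)) (f v - f u)) (le_trans (ler_normD _ _))//.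
  apply: le_trans (lerD (fB _ _ vr ur) (BC _)) _.
  by rewrite -mulrDl mulrC -ler_pdivlMr// ltW.
have psi_cont : {within A, continuous psi}.
  apply: continuous_in_subspaceT => u /[!inE] Au.
  apply: cvgD; last apply: cvgM; [|exact: cvg_cst|].
    by apply: cvg_norm; apply: cvgB; [exact: f_cont|exact: cvg_cst].
  by apply: cvg_norm; apply: cvgB; [exact: cvg_id|exact: cvg_cst].
have [|u Au umin] := @compact_EVT_min _ _ psi A _ (@closed_ball_compact _ _ u0 (r / 3)) psi_cont.
  by exists u0.
rewrite inE in Au.
have psiu : psi u <= `|f u0 - z|.
  by rewrite (le_trans (umin _ (mem_set Au0)))// /psi subrr normr0 mulr0 addr0.
have uu0 : `|u - u0| <= 4 * p * `|f u0 - z|.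
  rewrite -ler_pdivrMl ?mulr_gt0// (le_trans _ psiu)// /psi lerDr//.
exists u; split => //.
have uu0r : `|u - u0| <= r / 4.
  rewrite (le_trans uu0)// -ler_pdivlMl ?mulr_gt0//.
pose d := z - f u; have [/subr0_eq//|dN0] := eqVneq d 0.
have d0 : 0 < `|d| by rewrite normr_gt0.
pose s := Num.min 1 (r / 12 / (p * `|d|)).
have s0 : 0 < s by rewrite lt_min ltr01 !divr_gt0// mulr_gt0.
have s1 : s <= 1 by rewrite ge_min lexx.
have sPd : `|s *: P d| <= s * (p * `|d|).
  by rewrite normrZ gtr0_norm// ler_pM2l.
have sr : s * (p * `|d|) <= r / 12.
  by rewrite -ler_pdivlMr ?mulr_gt0// ge_min lexx orbT.
pose v := u + s *: P d.
have Av : A v.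
  rewrite /A/= /v addrAC (le_trans (ler_normD _ _))//; lra.
have := umin _ (mem_set Av); rewrite leNgt => /negP[].
rewrite /psi.
(* The step [s *: P d] removes [s |d|] from the residual; the linearization error and the growth of
   the penalty cost at most [s |d| / 4] each, so [psi] decreases strictly. *)
have h1 : `|f v - z| <= (4 * p)^-1 * (s * (p * `|d|)) + (1 - s) * `|d|.
  have -> : f v - z = (f v - f u - B (v - u)) + (s - 1) *: d.
    have -> : B (v - u) = s *: d by rewrite /v addrAC subrr add0r linearZ/= BP.
    by rewrite scalerBl scale1r addrA subrK /d opprB addrA subrK.
  rewrite (le_trans (ler_normD _ _))// lerD//; last first.
    by rewrite normrZ distrC ger0_norm// subr_ge0.
  rewrite (le_trans (fB _ _ (Ar _ Av) (Ar _ Au)))// ler_pM2l//.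
  by rewrite /v addrAC subrr add0r.
have h2 : `|v - u0| <= s * (p * `|d|) + `|u - u0|.
  by rewrite /v addrAC [leRHS]addrC (le_trans (ler_normD _ _))// lerD.
apply: le_lt_trans (lerD h1 (ler_wpM2l (ltW k0) h2)) _.
rewrite -(distrC z) -/d mulrDr addrA ltrD2r.
have -> : (4 * p)^-1 * (s * (p * `|d|)) = s * `|d| / 4 by field; rewrite gt_eqF.
have : 0 < s * `|d| by rewrite mulr_gt0.
lra.
Qed.

End MetricRegularity.

(** * Normal cones of reducible sets *)

Lemma convex_set_combination (R : realType) (E : normedModType R) (A : set E)
    (t : R) x z :
  convex_set (A : set (convex_lmodType E)) -> 0 <= t -> t <= 1 ->
  A x -> A z -> A (x + t *: (z - x)).
Proof.
move=> Aconv t0 t1 Ax Az.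
have := Aconv z x (Itv01 t0 t1) (mem_set Az) (mem_set Ax); rewrite inE.
rewrite -[conv _ _ _]/(t *: z + (1 - t) *: x).
by rewrite scalerBl scale1r scalerBr addrCA.
Qed.

Section Reduction.
Context {R : realType} {Y Z : euclideanType R}.
Variables (K : set Y) (y : Y) (U : set Y) (D : set Z) (Xi : Y -> Z).
Hypothesis Kconvex : convex_set (K : set (convex_lmodType Y)).
Hypothesis red : is_C2_reduction K y U D Xi.

Let Uopen : open U. Proof. by case: red => -[]. Qed.
Let Uy : U y. Proof. by case: red => -[]. Qed.
Let Xi0 : Xi y = 0. Proof. by case: red => _ _ _ []. Qed.
Let Xi_onto : range ('d Xi y) = setT. Proof. by case: red => _ _ _ []. Qed.

Let dXiU u : U u -> differentiable Xi u.
Proof. by case: red => _ _ C2 _ _ /C2[]. Qed.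

Let K_in_D u : K u -> U u -> D (Xi u).
Proof.
case: red => _ _ _ _ KU Ku Uu.
by have [] : (U `&` Xi @^-1` D) u by rewrite -KU.
Qed.

Let D_in_K u : U u -> D (Xi u) -> K u.
Proof.
case: red => _ _ _ _ KU Uu Du.
by have [] : (K `&` U) u by rewrite KU.
Qed.

Lemma reduction_cone (t : R) d : 0 <= t -> D d -> D (t *: d).
Proof. by case: red => _ [_ _ + _] _ _ _; apply. Qed.

Lemma reduction_cone0 : D 0.
Proof.
case: red => _ [_ _ _ D0] _ _ _.
by have [] : (D `&` [set - d | d in D]) 0 by rewrite D0.
Qed.

Lemma reduction_convex (t : R) d d' : 0 <= t -> t <= 1 -> D d -> D d' ->
  D (d + t *: (d' - d)).
Proof. by case: red => _ [_ Dc _ _] _ _ _; exact: convex_set_combination. Qed.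

(** [z + d] belongs to the convex cone [D], being twice a midpoint; testing [m] there gives
    [<m, d> <= 0], which is normality at the vertex. *)
Lemma normal_cone_vertex z m : normal_cone D z m -> normal_cone D (Xi y) m.
Proof.
rewrite Xi0 => -[Dz mD]; split=> [|d Dd]; first exact: reduction_cone0.
have half : 0 <= (2^-1 : R) <= 1 by rewrite invr_ge0 ler0n invf_le1// ler1n.
have /andP[h0 h1] := half.
have := mD _ (reduction_cone (ler0n R 2) (reduction_convex h0 h1 Dz Dd)).
rewrite scalerDr scalerA mulfV ?pnatr_eq0// scale1r scaler_nat mulr2n.
by rewrite [d - z]addrC !addrA addrK addrAC subrr add0r subr0.
Qed.

Lemma reduction_differentiable : \forall z \near y, differentiable Xi z.
Proof. by apply: filterS dXiU _; exact: open_nbhs_nbhs. Qed.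

Lemma reduction_differentiable2 v : differentiable (fun z => 'd Xi z v) y.
Proof. by case: red => -[_ Uy'] _ /(_ y Uy')[]. Qed.

Lemma reduction_regular : exists c r : R, [/\ 0 < c, 0 < r,
  forall u, `|u - y| < r -> U u &
  forall u0 z, `|u0 - y| < r -> `|z| < r ->
    exists u, [/\ U u, Xi u = z & `|u - u0| <= c * `|Xi u0 - z|]].
Proof.
have [P BP] := linear_section Xi_onto.
have [p p0 Pp] := linear_bounded P.
have k0 : 0 < (4 * p)^-1 by rewrite invr_gt0 mulr_gt0.
have [r1 r10 fB] := strict_differentiability reduction_differentiable
  reduction_differentiable2 k0.
have /nbhs_norm_lt[r2 r20 Ur2] : nbhs y U by exact: open_nbhs_nbhs.
have [C [r3 [C0 r30 Cr3]]] := differentiable_calm (dXiU Uy).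
pose q := Num.min r1 r2.
have q0 : 0 < q by rewrite lt_min r10.
have [q1 q2] : q <= r1 /\ q <= r2 by rewrite !ge_min !lexx orbT.
have fB' u v : `|u - y| < q -> `|v - y| < q ->
    `|Xi u - Xi v - 'd Xi y (u - v)| <= (4 * p)^-1 * `|u - v|.
  by move=> uq vq; apply: fB; exact: lt_le_trans q1.
(* [C * k + k] is exactly the residual that [metric_regularity] allows for the radius [q], and it
   bounds [|Xi u0| + |z|]. *)
pose k := (4 * p)^-1 * (q / 4) / (C + 1).
have k'0 : 0 < k by rewrite divr_gt0 ?mulr_gt0 ?divr_gt0 ?addr_gt0.
pose r := Num.min (Num.min (q / 2) r3) k.
have r0 : 0 < r by rewrite !lt_min r30 k'0 divr_gt0.
have [rq r_r3 rk] : [/\ r <= q / 2, r <= r3 & r <= k].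
  by split; rewrite !ge_min !lexx ?orbT.
exists (4 * p), r; split => //; first by rewrite mulr_gt0.
  by move=> u ur; apply: Ur2; lra.
move=> u0 z u0r zr.
have small : `|Xi u0 - z| <= (4 * p)^-1 * (q / 4).
  have -> : (4 * p)^-1 * (q / 4) = C * k + k.
    by rewrite /k; field; rewrite !gt_eqF// addr_gt0.
  rewrite (le_trans (ler_normB _ _))// lerD//; last by lra.
  have := Cr3 u0 (lt_le_trans u0r r_r3); rewrite Xi0 subr0 => /le_trans; apply.
  by rewrite ler_pM2l//; lra.
have [|u [fu uu0]] := metric_regularity BP p0 Pp q0 fB' _ small.
  exact: lt_le_trans u0r rq.
exists u; split => //; apply: Ur2.
have uq4 : `|u - u0| <= q / 4.
  by rewrite (le_trans uu0)// -ler_pdivlMl ?mulr_gt0.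
have -> : u - y = (u - u0) + (u0 - y) by rewrite addrA subrK.
by rewrite (le_lt_trans (ler_normD _ _))//; lra.
Qed.

Lemma Xi_small (e : R) : 0 < e -> exists2 r : R, 0 < r &
  forall u, `|u - y| < r -> `|Xi u| < e.
Proof.
move=> e0; have := differentiable_continuous (dXiU Uy).
move=> /cvgrPdist_lt/(_ _ e0)/nbhs_norm_lt[r r0]; rewrite Xi0 => rP.
by exists r => // u /rP; rewrite sub0r normrN.
Qed.

(** The vector [w] is tangent to [K] at [u]: [reduction_regular] corrects [u + t w] by [o(t)] to a
    point of [K] that [Xi] maps to [Xi u + t (d - Xi u)]. Testing [l] there and dividing by [t]
    leaves [<l, w> <= e]; [M] absorbs the factor [|l| c |w|] of the error. *)
Lemma normal_tangent_le0 : exists2 r : R, 0 < r &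
  forall u l w d, K u -> `|u - y| < r -> normal_cone K u l -> D d ->
    'd Xi u w = d - Xi u -> inner l w <= 0.
Proof.
have [c [q [c0 q0 qU reg]]] := reduction_regular.
have [q' q'0 Xq'] := Xi_small q0.
exists (Num.min q q'); first by rewrite lt_min q0.
move=> u l w d Ku; rewrite lt_min => /andP[uq uq'] [_ lK] Dd dw.
apply/ler_addgt0Pr => e e0; rewrite add0r.
pose M := `|l| * c * `|w| + 1.
have M0 : 0 < M by rewrite ltr_wpDl// !mulr_ge0// ltW.
have [q1 q10 q1P] := differentiable_littleo (dXiU (qU _ uq)) (divr_gt0 e0 M0).
have du : 0 < q - `|u - y| by rewrite subr_gt0.
have dX : 0 < q - `|Xi u| by rewrite subr_gt0 Xq'.
have w1 : 0 < `|w| + 1 by rewrite ltr_wpDl.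
have d1 : 0 < `|d - Xi u| + 1 by rewrite ltr_wpDl.
(* The bounds on [t] serve, in order, the differentiability remainder at [u], the two smallness
   conditions of [reg], and convexity of [D] on the segment from [Xi u] to [d]. *)
pose t := Num.min (Num.min (Num.min (q1 / (`|w| + 1)) ((q - `|u - y|) / (`|w| + 1)))
   ((q - `|Xi u|) / (`|d - Xi u| + 1))) 1.
have t0 : 0 < t by rewrite !lt_min ltr01 !divr_gt0.
have t1 : t <= 1 by rewrite ge_min lexx orbT.
have tw (b : R) : t <= b / (`|w| + 1) -> `|t *: w| < b.
  rewrite ler_pdivlMr// normrZ gtr0_norm// => /(lt_le_trans _); apply.
  by rewrite ltr_pM2l// ltrDl.
have twq1 : `|t *: w| < q1 by apply: tw; rewrite !ge_min lexx.
have twq : `|t *: w| < q - `|u - y| by apply: tw; rewrite !ge_min lexx orbT.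
have tdq : `|t *: (d - Xi u)| < q - `|Xi u|.
  have : t <= (q - `|Xi u|) / (`|d - Xi u| + 1) by rewrite !ge_min lexx !orbT.
  rewrite ler_pdivlMr// normrZ gtr0_norm// => /(lt_le_trans _); apply.
  by rewrite ltr_pM2l// ltrDl.
have [||v [Uv Xv uv]] := reg (u + t *: w) (Xi u + t *: (d - Xi u)).
- by rewrite addrAC (le_lt_trans (ler_normD _ _))// -ltrBrDl.
- by rewrite (le_lt_trans (ler_normD _ _))// -ltrBrDl.
have Kv : K v.
  apply: D_in_K => //; rewrite Xv; apply: reduction_convex (ltW t0) t1 _ Dd.
  exact: K_in_D (qU _ uq).
have := lK _ Kv; rewrite -(subrK (u + t *: w) v) -addrA [u + _]addrC addrK.
rewrite innerDr innerZr [t *: w + u]addrC => lv.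
rewrite -(ler_pM2l t0).
have : - inner l (v - (u + t *: w)) <= `|l| * (c * `|Xi (u + t *: w) - (Xi u + t *: (d - Xi u))|).
  rewrite (le_trans (ler_norm _))// normrN (le_trans (cauchy_schwarz _ _))//.
  by rewrite ler_wpM2l.
have : `|l| * (c * `|Xi (u + t *: w) - (Xi u + t *: (d - Xi u))|) <= t * e.
  have -> : Xi (u + t *: w) - (Xi u + t *: (d - Xi u)) =
     Xi (u + t *: w) - Xi u - 'd Xi u (t *: w).
    by rewrite linearZ/= dw opprD addrA.
  have := q1P _ twq1; rewrite normrZ gtr0_norm// => h.
  rewrite mulrA; apply: le_trans (ler_wpM2l _ h) _; first by rewrite mulr_ge0// ltW.
  have -> : `|l| * c * (e / M * (t * `|w|)) = t * e * ((M - 1) / M).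
    by rewrite /M; field; rewrite gt_eqF.
  by rewrite ler_piMr ?(ltW (mulr_gt0 _ _))// ler_pdivrMr// mul1r gerBl.
lra.
Qed.

(** Near [y] the composite of ['d Xi u] with the right inverse [P] stays within [1/2] of the
    identity, so it is injective and, by dimension, onto. In [<m, m> = <adjoint ('d Xi u) m, P m> -
    <m, 'd Xi u (P m) - m>] the last term is at most half of [|m|^2], whence the constant
    [2 * p]. *)
Lemma adjoint_coercive : exists c r : R, [/\ 0 < c, 0 < r &
  forall u, `|u - y| < r ->
    range ('d Xi u) = setT /\ forall m, `|m| <= c * `|adjoint ('d Xi u) m|].
Proof.
have [P BP] := linear_section Xi_onto.
have [p p0 Pp] := linear_bounded P.
have [C [r [C0 r0 Cr]]] := diff_calm reduction_differentiable2.
exists (2 * p), (Num.min r (2 * C * p)^-1); split; rewrite ?mulr_gt0//.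
  by rewrite lt_min r0 invr_gt0 !mulr_gt0.
move=> u; rewrite lt_min => /andP[ur uC].
have near_id z : `|'d Xi u (P z) - z| <= 2^-1 * `|z|.
  rewrite -{2}(BP z) (le_trans (Cr u ur _))//.
  apply: (@le_trans _ _ (C * `|u - y| * (p * `|z|))).
    by rewrite ler_wpM2l// mulr_ge0// ltW.
  rewrite mulrA ler_wpM2r// -ler_pdivlMr// -ler_pdivlMl//.
  suff <- : (2 * C * p)^-1 = C^-1 * (2^-1 / p) by exact: ltW.
  by field; rewrite !gt_eqF.
split.
  pose A := (linfun ('d Xi u) \o linfun P)%VF.
  have AE z : A z = 'd Xi u (P z) by rewrite lfunE/= !lfunE.
  have kA : lker A == 0%VS.
    apply/lker0P/raddf_inj => z Az; apply/eqP; rewrite -normr_le0.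
    by have := near_id z; rewrite -AE Az sub0r normrN; lra.
  apply/seteqP; split=> // z _; exists (P ((A^-1)%VF z)) => //.
  by rewrite -AE lker0_lfunVK.
move=> m; have [->|mN0] := eqVneq m 0.
  by rewrite normr0 mulr_ge0// mulr_ge0// ltW.
have m0 : 0 < `|m| by rewrite normr_gt0.
rewrite -(ler_pM2r m0) -expr2 -inner_norm.
have : inner m m = inner (adjoint ('d Xi u) m) (P m) - inner m ('d Xi u (P m) - m).
  by rewrite adjointP innerBr opprB subrKC.
have := inner_le (adjoint ('d Xi u) m) (P m).
have := cauchy_schwarz m ('d Xi u (P m) - m).
have := ler_wpM2l (normr_ge0 m) (near_id m).
have := ler_wpM2l (normr_ge0 (adjoint ('d Xi u) m)) (Pp m).
rewrite inner_norm ler_norml => h1 h2 /andP[h3 _] h4 h5.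
nra.
Qed.

(** The multiplier is the image of [l] under the adjoint of a right inverse [P] of ['d Xi u]. Taking
    [d = Xi u] in [normal_tangent_le0], for a kernel vector and its opposite, shows that [l]
    vanishes on the kernel and so factors through ['d Xi u]; general [d] gives normality. *)
Lemma normal_cone_multiplier : exists c r : R, [/\ 0 < c, 0 < r &
  forall u l, K u -> `|u - y| < r -> normal_cone K u l -> exists m,
    [/\ normal_cone D (Xi u) m, l = adjoint ('d Xi u) m &
        `|m| <= c * `|l|]].
Proof.
have [c [r [c0 r0 cr]]] := adjoint_coercive.
have [r' r'0 tan] := normal_tangent_le0.
have /nbhs_norm_lt[r2 r20 Ur2] : nbhs y U by exact: open_nbhs_nbhs.
exists c, (Num.min (Num.min r r') r2); split; rewrite ?lt_min ?r0 ?r'0//.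
move=> u l Ku; rewrite !lt_min => /andP[/andP[ur ur'] ur2] Nl.
have [onto coer] := cr u ur.
have [P BP] := linear_section onto.
have DXu : D (Xi u) by apply: K_in_D => //; exact: Ur2.
have lE : l = adjoint ('d Xi u) (adjoint P l).
  apply: inner_inj => w; rewrite !adjointP.
  apply/subr0_eq; rewrite -innerBr; apply/eqP; rewrite eq_le.
  have ker w' : 'd Xi u w' = 0 -> inner l w' <= 0.
    by move=> w'0; apply: (tan u l w' (Xi u)) => //; rewrite subrr.
  rewrite ker/=; last by rewrite linearB/= BP subrr.
  by rewrite -oppr_le0 -innerNr ker// linearN linearB/= BP subrr oppr0.
exists (adjoint P l); split => //; last by rewrite {2}lE.
split=> // d Dd; rewrite adjointP.
by apply: (tan u l _ d) => //; rewrite BP.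
Qed.

(** Normality to [K] is global while [Xi] describes [K] only on [U]: convexity of [K] moves the test
    point [k] along its segment into [U], where the first-order expansion of [Xi] is divided by
    [t]. *)
Lemma normal_cone_adjoint u m :
  K u -> U u -> normal_cone D (Xi u) m -> normal_cone K u (adjoint ('d Xi u) m).
Proof.
move=> Ku Uu [_ mD]; split=> // k Kk; rewrite adjointP.
apply/ler_addgt0Pr => e e0; rewrite add0r; set w := k - u.
pose M := `|m| * `|w| + 1.
have M0 : 0 < M by rewrite ltr_wpDl// mulr_ge0.
have [q q0 qP] := differentiable_littleo (dXiU Uu) (divr_gt0 e0 M0).
have /nbhs_norm_lt[r r0 Ur] : nbhs u U by exact: open_nbhs_nbhs.
have w1 : 0 < `|w| + 1 by rewrite ltr_wpDl.
pose t := Num.min (Num.min q r / (`|w| + 1)) 1.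
have t0 : 0 < t by rewrite !lt_min ltr01 divr_gt0// lt_min q0.
have t1 : t <= 1 by rewrite ge_min lexx orbT.
have : `|t *: w| < Num.min q r.
  have : t <= Num.min q r / (`|w| + 1) by rewrite ge_min lexx.
  rewrite ler_pdivlMr// normrZ gtr0_norm// => /(lt_le_trans _); apply.
  by rewrite ltr_pM2l// ltrDl.
rewrite lt_min => /andP[twq twr].
have Kt : K (u + t *: w) by exact: convex_set_combination (ltW t0) t1 Ku Kk.
have Ut : U (u + t *: w) by apply: Ur; rewrite addrAC subrr add0r.
have := mD _ (K_in_D Kt Ut); have := qP _ twq.
rewrite linearZ/= normrZ gtr0_norm//.
set a := Xi _ - Xi u => h1 h2.
rewrite -(ler_pM2l t0) -innerZr.
have -> : t *: 'd Xi u w = a - (a - t *: 'd Xi u w) by rewrite opprB addrC subrK.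
rewrite innerBr.
have h3 := cauchy_schwarz m (a - t *: 'd Xi u w).
have h4 := ler_wpM2l (normr_ge0 m) h1.
have h5 : `|m| * (e / M * (t * `|w|)) <= t * e.
  have -> : `|m| * (e / M * (t * `|w|)) = t * e * ((M - 1) / M).
    by rewrite /M; field; rewrite gt_eqF.
  by rewrite ler_piMr ?(ltW (mulr_gt0 _ _))// ler_pdivrMr// mul1r gerBl.
move: h3; rewrite ler_norml => /andP[h3 _]; lra.
Qed.

End Reduction.

(** * Tangent directions and graphical derivatives *)

Section ContingentCone.
Context {R : realType}.

(** Limits along any proper filter, such as the ultrafilter of the blow-up, are turned into the
    sequences of [contingent_cone] by choosing one index for each tolerance [1 / (n + 1)]. *)
Lemma contingent_cone_filter (E : normedModType R) (S : set E) y v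
    (T : Type) (G : set_system T) {FG : ProperFilter G} (t : T -> R) (d : T -> E) :
  (forall k, 0 < t k) -> t @ G --> (0 : R) -> d @ G --> v ->
  (\forall k \near G, S (y + t k *: d k)) -> contingent_cone S y v.
Proof.
move=> t0 tG dG SG.
have pick (n : nat) : exists k, [/\ t k < n.+1%:R^-1, `|v - d k| < n.+1%:R^-1
    & S (y + t k *: d k)].
  have n0 : 0 < n.+1%:R^-1 :> R by rewrite invr_gt0.
  have tn : \forall k \near G, t k < n.+1%:R^-1.
    move/cvgrPdist_lt : tG => /(_ _ n0); apply: filterS => k.
    by rewrite sub0r normrN gtr0_norm.
  have dn : \forall k \near G, `|v - d k| < n.+1%:R^-1 by move/cvgrPdist_lt : dG; exact.
  have [k [? [? ?]]] := filter_ex (filterI tn (filterI dn SG)).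
  by exists k.
have [s sP] := choice pick.
exists (t \o s), (d \o s); split => //=.
- apply/cvgrPdist_lt => e e0.
  move/cvgrPdist_lt : (@cvg_harmonic R) => /(_ _ e0); apply: filterS => k /=.
  rewrite !sub0r !normrN gtr0_norm ?invr_gt0// gtr0_norm//; apply: lt_trans.
  by have [] := sP k.
- apply/cvgrPdist_lt => e e0.
  move/cvgrPdist_lt : (@cvg_harmonic R) => /(_ _ e0); apply: filterS => k /=.
  rewrite sub0r normrN gtr0_norm ?invr_gt0//; apply: lt_trans.
  by have [] := sP k.
- by move=> k; have [] := sP k.
Qed.

End ContingentCone.

Section ReductionLimits.
Context {R : realType} {Y Z : euclideanType R}.
Variables (K : set Y) (y : Y) (U : set Y) (D : set Z) (Xi : Y -> Z).
Hypothesis Kconvex : convex_set (K : set (convex_lmodType Y)).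
Hypothesis red : is_C2_reduction K y U D Xi.

Let Uopen : open U. Proof. by case: red => -[]. Qed.
Let Uy : U y. Proof. by case: red => -[]. Qed.
Let Xi0 : Xi y = 0. Proof. by case: red => _ _ _ []. Qed.

Lemma contingent_cone_reduction h : contingent_cone K y h -> D ('d Xi y h).
Proof.
move=> [t [d [t0 t_cvg d_cvg Kd]]].
have [_ [Dclosed _ _ _] C2 _ KU] := red; have [dXi _ _] := C2 _ Uy.
have q_cvg : (fun k => (t k)^-1 *: (Xi (y + t k *: d k) - Xi y)) @ \oo --> 'd Xi y h.
  exact: cvg_difference_quotient.
apply: (closed_cvg D Dclosed _ _ q_cvg).
have td : (fun k => y + t k *: d k) @ \oo --> y.
  rewrite -[X in _ --> X]addr0; apply: cvgD; first exact: cvg_cst.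
  by rewrite -(scale0r h); exact: cvgZ.
have : \forall k \near \oo, U (y + t k *: d k).
  by apply: td; exact: open_nbhs_nbhs.
apply: filterS => k Uk; rewrite Xi0 subr0.
apply: (reduction_cone red); first by rewrite invr_ge0 ltW.
by have [] : (U `&` Xi @^-1` D) (y + t k *: d k) by rewrite -KU.
Qed.

(** An explicit curve in the graph. The point [u k] solves [Xi u = t k *: d] with [d = 'd Xi y h],
    so it leaves [y] in the direction [h]; its multiplier is [mu + t k *: (nu + s *: mu)], where
    [nu] represents [n]. As [mu] and [nu] are orthogonal to [d], this is normal to [D] at [t k *: d]
    once [1 + t k * s >= 0], which is how a negative [s] is allowed. *)
Lemma graphical_derivative_normal_cone mu l h n (s : R) :
  K y -> normal_cone D (Xi y) mu -> l = adjoint ('d Xi y) mu ->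
  critical_cone K y l h -> normal_cone K y n -> inner n h = 0 ->
  graphical_derivative (normal_cone K) y l h
    (2^-1 *: gradient (Upsilon Xi mu y) h + (n + s *: l)).
Proof.
move=> Ky [_ muD] lE [Th hl] Nn nh.
have dXi := reduction_differentiable red.
have ddXi := reduction_differentiable2 red.
have dXiy := nbhs_singleton dXi.
have [c0 [r0 [_ r00 multP]]] := normal_cone_multiplier red.
have [|nu [[_ nuD] nE _]] := multP y n Ky _ Nn; first by rewrite subrr normr0.
pose d := 'd Xi y h; have Dd : D d by exact: contingent_cone_reduction.
have nud : inner nu d = 0 by rewrite -adjointP -nE.
have mud : inner mu d = 0 by rewrite -adjointP -lE innerC.
have [c [r [c_gt0 r_gt0 rU reg]]] := reduction_regular red.
(* With [t k = 1 / (M (k + 1))] the bounds [t k * |s| <= 1], [t k * |d| < r] and [t k * |h| < r]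
   hold at every index, as the definition of [contingent_cone] demands. *)
pose M := `|s| + `|d| / r + `|h| / r + 1.
have M0 : 0 < M by rewrite ltr_wpDl// !addr_ge0// divr_ge0// ltW.
pose t k : R := M^-1 * k.+1%:R^-1.
have t0 k : 0 < t k by rewrite mulr_gt0// invr_gt0.
have tM k : t k * M <= 1.
  by rewrite /t mulrAC mulVf ?gt_eqF// mul1r invf_le1// ler1n.
have t_cvg : t @ \oo --> (0 : R).
  by rewrite -(mulr0 M^-1); apply: cvgM; [exact: cvg_cst|exact: cvg_harmonic].
have M_ge : [/\ `|s| <= M, `|d| < r * M & `|h| < r * M].
  have dr : 0 <= `|d| / r by rewrite divr_ge0// ltW.
  have hr : 0 <= `|h| / r by rewrite divr_ge0// ltW.
  have s0 := normr_ge0 s.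
  split; rewrite /M; first lra.
    by rewrite -ltr_pdivrMl// mulrC; lra.
  by rewrite -ltr_pdivrMl// mulrC; lra.
have [sM dM hM] := M_ge.
have t_small (v : R) k : v < r * M -> t k * v < r.
  move=> vM; rewrite -(ltr_pM2l (t0 k)) in vM.
  by rewrite (lt_le_trans vM)// mulrCA ler_piMr// ltW.
have /choice[u uP] k : exists u, [/\ U u, Xi u = t k *: d &
    `|u - (y + t k *: h)| <= c * `|Xi (y + t k *: h) - t k *: d|].
  apply: reg; first by rewrite addrAC subrr add0r normrZ gtr0_norm// t_small.
  by rewrite normrZ gtr0_norm// t_small.
pose dz k := (t k)^-1 *: (u k - y).
have uE k : u k = y + t k *: dz k.
  by rewrite scalerA mulfV ?gt_eqF// scale1r subrKC.
have dz_cvg : dz @ \oo --> h.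
  have h_cvg : (fun _ : nat => h) @ \oo --> h by exact: cvg_cst.
  have q_cvg : (fun k => (t k)^-1 *: (Xi (y + t k *: h) - Xi y)) @ \oo --> 'd Xi y h.
    exact: cvg_difference_quotient.
  apply/cvgrPdist_le => e e0.
  move/cvgrPdist_le : q_cvg => /(_ _ (divr_gt0 e0 c_gt0)); apply: filterS => k.
  rewrite ler_pdivlMr// Xi0 subr0 mulrC => /(le_trans _); apply.
  have [_ _ uk] := uP k.
  have -> : h - dz k = - ((t k)^-1 *: (u k - (y + t k *: h))).
    by rewrite opprD addrA scalerBr scalerA mulVf ?gt_eqF// scale1r opprB.
  have -> : 'd Xi y h - (t k)^-1 *: Xi (y + t k *: h) =
      - ((t k)^-1 *: (Xi (y + t k *: h) - t k *: d)).
    by rewrite scalerBr scalerA mulVf ?gt_eqF// scale1r opprB.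
  by rewrite !normrN !normrZ mulrCA ler_pM2l ?normr_gt0 ?invr_eq0 ?gt_eqF.
pose m k := mu + t k *: (nu + s *: mu).
have m_cvg : m @ \oo --> mu.
  rewrite -[X in _ --> X]addr0; apply: cvgD; first exact: cvg_cst.
  by rewrite -(scale0r (nu + s *: mu)); apply: cvgZr_tmp.
have Nm k : normal_cone D (Xi (u k)) (m k).
  have [_ -> _] := uP k; split; first exact: (reduction_cone red (ltW (t0 k))).
  move=> d' Dd'; rewrite innerBr innerZr /m innerDl !innerZl innerDl innerZl.
  rewrite innerDl !innerZl innerDl innerZl nud mud !(mulr0, addr0, subr0).
  have := muD _ Dd'; have := nuD _ Dd'; rewrite Xi0 subr0 => nu_le mu_le.
  have : -1 <= t k * s.
    have := normr_ge0 s; have := ler_norm (- s); rewrite normrN => s1 s2.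
    have := tM k; have := ler_wpM2l (ltW (t0 k)) sM; have := ler_wpM2l (ltW (t0 k)) s1.
    by rewrite mulrN; lra.
  by have := t0 k; nra.
pose dw k := (t k)^-1 *: (adjoint ('d Xi (u k)) (m k) - l).
exists t, (fun k => (dz k, dw k)); split => //.
- apply: cvg_pair => //=.
  (* Inserting [adjoint ('d Xi y) (m k)] separates the curvature quotient from the multiplier
     increment, which after division by [t k] is exactly [n + s *: l]. *)
  have -> : dw = (fun k => (t k)^-1 *: (adjoint ('d Xi (y + t k *: dz k)) (m k)
       - adjoint ('d Xi y) (m k)) + (n + s *: l)).
    apply/funext => k; rewrite /dw -uE {1}lE -{1}(subrK (adjoint ('d Xi y) (m k)) (adjoint _ _)).
    rewrite -addrA scalerDr; congr (_ + _).
    rewrite -adjointB /m addrAC subrr add0r adjointZ scalerA mulVf ?gt_eqF//.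
    by rewrite scale1r adjointD adjointZ -nE -lE.
  apply: cvgD; last exact: cvg_cst.
  exact: (cvg_adjoint_quotient dXi ddXi).
- move=> k; rewrite /graph/=.
  have -> : l + t k *: dw k = adjoint ('d Xi (u k)) (m k).
    by rewrite /dw (scalerKV (lt0r_neq0 (t0 k))) subrKC.
  rewrite -uE.
  have [Uk Xk _] := uP k.
  apply: (normal_cone_adjoint Kconvex red) => //.
  have [_ _ _ _ KU] := red.
  have [] // : (K `&` U) (u k).
  by rewrite KU; split => //=; rewrite Xk; exact: (reduction_cone red (ltW (t0 k))).
Qed.

End ReductionLimits.

(** * Linear regularity of normal cones *)

Section LinearSubspace.
Context {R : realType} {E F : euclideanType R}.

(** A linear subspace of maximal dimension inside [S] exhausts it, since any further [x] could be
    adjoined. *)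
Lemma subspace_vspace (S : set E) :
  S 0 -> (forall a u v, S u -> S v -> S (a *: u + v)) ->
  exists V : {vspace E}, forall x, S x <-> x \in V.
Proof.
move=> S0 SP.
pose P n := `[< exists V : {vspace E}, \dim V = n /\ forall x, x \in V -> S x >].
have P0 : exists n, P n.
  exists 0%N; apply/asboolP; exists 0%VS; split; first exact: dimv0.
  by move=> x /[!memv0]/eqP->.
have Pb n : P n -> (n <= \dim {:E})%N.
  by move=> /asboolP[V [<- _]]; exact/dimvS/subvf.
case: (ex_maxnP P0 Pb) => n /asboolP[V [Vn VS]] nmax.
exists V => x; split; last exact: VS.
move=> Sx; apply: contrapT => /negP xV.
have Vx : (\dim V < \dim (V + <[x]>))%N.
  rewrite ltn_neqAle (dimvS (addvSl _ _)) andbT; apply/negP => /eqP dVx.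
  have : (V == V + <[x]>)%VS by rewrite eqEdim addvSl dVx /=.
  move=> /eqP VE; case/negP: xV; rewrite VE.
  exact: (subvP (addvSr _ _) _ (memv_line x)).
suff : P (\dim (V + <[x]>)) by move=> /nmax; rewrite -Vn leqNgt Vx.
apply/asboolP; exists (V + <[x]>)%VS; split=> // _ /memv_addP[u uV [_ /vlineP[a ->] ->]].
by rewrite addrC; apply: SP => //; exact: VS.
Qed.

(** [Q] serves twice: it selects preimages in [S] with a linear bound, and, [A \o Q] being
    continuous, it shows that the image of [S] is closed. *)
Lemma subspace_section (S : set E) (A : {linear E -> F}) :
  S 0 -> (forall a u v, S u -> S v -> S (a *: u + v)) ->
  exists Q : {linear F -> E},
    (forall z, S (Q z)) /\ (forall s, S s -> A (Q (A s)) = A s).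
Proof.
move=> S0 /(subspace_vspace S0)[V SV].
pose f := (linfun A \o projv V)%VF.
exists (projv V \o f^-1)%VF; split=> [z|s /SV sV].
  by apply/SV; rewrite /= comp_lfunE memv_proj.
have fs : f s = A s by rewrite comp_lfunE lfunE/= projv_id.
have : f ((f^-1)%VF (A s)) = A s by rewrite limg_lfunVK// -fs memv_img// memvf.
by rewrite /= !comp_lfunE lfunE.
Qed.

End LinearSubspace.

Section NormalCone.
Context {R : realType} {E : euclideanType R} (K : set E) (y : E).
Lemma normal_cone0 : K y -> normal_cone K y 0.
Proof. by move=> Ky; split=> [//|z _]; rewrite inner0l. Qed.

Lemma normal_coneD u v :
  normal_cone K y u -> normal_cone K y v -> normal_cone K y (u + v).
Proof.
move=> [Ky Nu] [_ Nv]; split=> // z Kz; rewrite innerDl.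
by rewrite -(addr0 0) lerD ?Nu ?Nv.
Qed.

Lemma normal_coneZ (a : R) u :
  0 <= a -> normal_cone K y u -> normal_cone K y (a *: u).
Proof.
by move=> a0 [Ky Nu]; split=> // z Kz; rewrite innerZl mulr_ge0_le0 ?Nu.
Qed.

(** The normal cone being a convex cone, this is its linear span, the direction space of its affine
    hull. *)
Definition normal_span : set E :=
  [set s | exists n1 n2, [/\ normal_cone K y n1, normal_cone K y n2 & s = n1 - n2]].

Lemma normal_span_sub n1 n2 :
  normal_cone K y n1 -> normal_cone K y n2 -> normal_span (n1 - n2).
Proof. by exists n1, n2. Qed.

Lemma normal_span_lin (a : R) u v :
  normal_span u -> normal_span v -> normal_span (a *: u + v).
Proof.
move=> [m1 [m2 [Nm1 Nm2 ->]]] [n1 [n2 [Nn1 Nn2 ->]]].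
have [a0|/ltW a0] := leP 0 a.
  rewrite scalerBr addrACA -opprD.
  by apply: normal_span_sub; apply: normal_coneD => //; exact: normal_coneZ.
rewrite -[a]opprK scaleNr scalerBr opprB addrACA -opprD.
by apply: normal_span_sub; apply: normal_coneD => //; apply: normal_coneZ => //; rewrite oppr_ge0.
Qed.

Lemma normal_span0 : K y -> normal_span 0.
Proof. by move=> Ky; rewrite -(subrr 0); apply: normal_span_sub; exact: normal_cone0. Qed.

Lemma relative_interior_normal_cone l :
  relative_interior (normal_cone K y) l -> exists2 e : R, 0 < e &
    forall s, normal_span s -> `|s| < e -> normal_cone K y (l + s).
Proof.
move=> [Nl [e e0 ball_sub]]; exists e => // _ [n1 [n2 [Nn1 Nn2 ->]]] se.
apply: ball_sub; split.
  by rewrite -ball_normE /= opprD addrA subrr sub0r normrN.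
move=> A [Aaff NA].
(* An affine combination, with weights [2] and [-1], of the normals [(l + n1) / 2] and [n2]. *)
have -> : l + (n1 - n2) = (1 - (-1)) *: (2^-1 *: (l + n1)) + (-1) *: n2.
  by rewrite opprK scalerA mulfV// scale1r scaleN1r addrA.
apply: Aaff; apply: NA => //; apply: normal_coneZ; first by rewrite invr_ge0.
exact: normal_coneD.
Qed.

Lemma normal_cone_contingent l v :
  normal_cone K y l -> contingent_cone K y v -> inner l v <= 0.
Proof.
move=> [_ Nl] [t [d [t0 tG dG Kd]]].
have ld : (fun k => inner l (d k)) @ \oo --> inner l v.
  by apply: cvg_inner => //; exact: cvg_cst.
apply: (closed_cvg (fun x : R => x <= 0) _ _ _ ld); first exact: closed_le.
near=> k; have := Nl _ (Kd k); rewrite addrAC subrr add0r innerZr.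
by rewrite pmulr_rle0.
Unshelve. all: by end_near. Qed.

End NormalCone.

(* A Hoffman-type bound: the relative interior point [lh] of the cone makes it
   linearly regular with respect to the affine subspace [A q = A lh]. *)
Lemma normal_cone_affine_regularity (R : realType) (E F : euclideanType R)
    (K : set E) (y : E) (A : {linear E -> F}) (lh : E) :
  K y -> relative_interior (normal_cone K y) lh ->
  exists2 C : R, 0 < C & forall p, normal_cone K y p -> exists q,
    [/\ normal_cone K y q, A q = A lh &
        `|q - p| <= C * `|A p - A lh| * (1 + `|p|)].
Proof.
move=> Ky ri_lh; have Nlh : normal_cone K y lh by case: ri_lh.
have [e e0 eP] := relative_interior_normal_cone ri_lh.
have [Q [SQ AQ]] := subspace_section A (normal_span0 Ky) (@normal_span_lin _ _ K y).
have [c c0 Qc] := linear_bounded Q.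
have [al al0 al_e] : exists2 al : R, 0 < al & al < e by exists (e / 2); lra.
exists (c * (1 + (`|lh| + 1) / al)).
  by rewrite mulr_gt0// ltr_wpDr// divr_ge0 ?addr_ge0// ltW.
move=> p Np; pose rho := A p - A lh.
have Arho : A (Q rho) = rho by rewrite /rho -linearB AQ//; exact: normal_span_sub.
(* [A s = A lh - A p], so [p + s] has the required image, but it may leave the cone. *)
pose s := - Q rho; pose be := `|s|.
have s_le : be <= c * `|rho| by rewrite /be normrN.
have be0 : 0 <= be by exact: normr_ge0.
have d0 : 0 < be + al by rewrite ltr_wpDl.
have Ss : normal_span K y s.
  by rewrite /s -scaleN1r -[_ *: _]addr0; apply: normal_span_lin => //; exact: normal_span0.
(* Adding [lh] with weight [be] restores normality: after factoring out [be], the perturbation of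
   [lh] has norm [al < e]. The case [s = 0] is separate because of the division by [be]. *)
have Nshift : normal_cone K y (be *: lh + al *: s).
  have [s0|sN0] := eqVneq s 0.
    by rewrite s0 scaler0 addr0 /be s0 normr0 scale0r; exact: normal_cone0.
  have be_gt0 : 0 < be by rewrite normr_gt0.
  have -> : be *: lh + al *: s = be *: (lh + (al / be) *: s).
    by rewrite scalerDr scalerA mulrCA mulfV ?mulr1// gt_eqF.
  apply: normal_coneZ => //; apply: eP.
    by rewrite -[_ *: _]addr0; apply: normal_span_lin => //; exact: normal_span0.
  by rewrite normrZ ger0_norm ?divr_ge0 ?ltW// divfK ?gt_eqF.
(* The convex combination of [p + s] and [lh] with weights proportional to [al] and [be]; both
   vectors have the image [A lh]. *)
exists ((be + al)^-1 *: (al *: p + (be *: lh + al *: s))); split.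
- apply: normal_coneZ; first by rewrite invr_ge0 ltW.
  by apply: normal_coneD => //; apply: normal_coneZ => //; exact: ltW.
- have As : A s = A lh - A p by rewrite linearN Arho opprB.
  rewrite (linearZZ A) !(linearD A) !(linearZZ A) As scalerBr.
  rewrite [X in _ *: X]addrC -addrA subrK -scalerDl.
  by rewrite scalerA mulVf ?scale1r// gt_eqF.
have -> : (be + al)^-1 *: (al *: p + (be *: lh + al *: s)) - p =
    (be + al)^-1 *: (be *: (lh - p) + al *: s).
  have pE : p = (be + al)^-1 *: ((be + al) *: p).
    by rewrite scalerA mulVf ?scale1r// gt_eqF.
  rewrite {2}pE -scalerBr.
  congr (_ *: _); rewrite scalerDl scalerBr [al *: p + _]addrC opprD addrA.
  by rewrite addrAC addrK addrAC.
rewrite normrZ gtr0_norm ?invr_gt0// ler_pdivrMl//.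
have h1 : `|be *: (lh - p) + al *: s| <= be * (`|lh| + `|p| + al).
  rewrite (le_trans (ler_normD _ _))// !normrZ (ger0_norm be0) gtr0_norm//.
  rewrite [leRHS]mulrDr [be * al]mulrC.
  by apply: lerD; [rewrite ler_wpM2l// ler_normB|exact: lexx].
apply: le_trans h1 _.
have h2 : al * (c * (1 + (`|lh| + 1) / al) * `|rho| * (1 + `|p|)) =
    c * `|rho| * ((al + `|lh| + 1) * (1 + `|p|)) by field; rewrite gt_eqF.
apply: (@le_trans _ _ (al * (c * (1 + (`|lh| + 1) / al) * `|rho| * (1 + `|p|)))); last first.
  have c1 : 0 <= 1 + (`|lh| + 1) / al.
    by rewrite addr_ge0// divr_ge0 ?addr_ge0// ltW.
  apply: ler_wpM2r; last by rewrite lerDr.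
  by rewrite (mulr_ge0 (mulr_ge0 (mulr_ge0 (ltW c0) c1) _))// addr_ge0.
rewrite h2 ler_pM//; first by rewrite !addr_ge0// ltW.
have := normr_ge0 p; have := normr_ge0 lh; nra.
Qed.

(** * Gradients and the Lagrangian *)

Section Gradient.
Context {R : realType} {E : euclideanType R}.

Lemma inner_gradient (h : E -> R) x v : inner (gradient h x) v = 'd h x v.
Proof. exact: rieszP. Qed.

Lemma gradient_differentiable (h : E -> R) x :
  (forall v, differentiable (fun z => 'd h z v) x) ->
  differentiable (gradient h) x.
Proof.
move=> dh; rewrite (_ : gradient h = fun z => \sum_(u <- frame) 'd h z u *: u).
  elim: frame => [|u s IH].
    rewrite (_ : (fun _ => _) = cst 0); first exact: differentiable_cst.
    by apply/funext => z; rewrite big_nil.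
  rewrite (_ : (fun _ => _) =
    (fun z => 'd h z u *: u) + (fun z => \sum_(v <- s) 'd h z v *: v)).
    by apply: differentiableD => //; exact: differentiableZl.
  by apply/funext => z; rewrite big_cons.
apply/funext => z; rewrite [LHS]frameE; apply: eq_bigr => u _.
by rewrite inner_gradient.
Qed.

End Gradient.

Section KKTEstimates.
Context {R : realType} {X Y : euclideanType R}.
Variables (f : X -> R) (g : X -> Y) (K : set Y).
Hypotheses (f_C2 : C2_on setT f) (g_C2 : C2_on setT g).

Let df x : differentiable f x. Proof. by have [] := f_C2 (I : setT x). Qed.
Let dg x : differentiable g x. Proof. by have [] := g_C2 (I : setT x). Qed.
Let ddf x v : differentiable (fun z => 'd f z v) x.
Proof. by have [] := f_C2 (I : setT x). Qed.
Let ddg x v : differentiable (fun z => 'd g z v) x.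
Proof. by have [] := g_C2 (I : setT x). Qed.

Lemma diff_lagrangian l x v :
  'd (lagrangian f g l) x v = 'd f x v + inner l ('d g x v).
Proof.
have dl : is_diff (g x) (inner l) (inner l).
  have lc := @linear_continuous _ _ _ (inner_form l).
  apply: DiffDef; first exact: (linear_differentiable (f := inner_form l)).
  exact: (diff_lin (f := inner_form l)).
have dL := is_diffD (differentiableP (df x))
  (is_diff_comp (differentiableP (dg x)) dl).
by rewrite (@diff_val _ _ _ _ _ _ _ dL).
Qed.

Lemma gradient_lagrangian l x :
  gradient (lagrangian f g l) x = gradient f x + adjoint ('d g x) l.
Proof.
apply: inner_inj => v.
by rewrite inner_gradient diff_lagrangian innerDl inner_gradient adjointP.
Qed.

Lemma gradient_lagrangian_differentiable l x :
  differentiable (gradient (lagrangian f g l)) x.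
Proof.
apply: gradient_differentiable => v.
rewrite (_ : (fun z => _) = (fun z => 'd f z v) + (inner_form l \o (fun z => 'd g z v))).
  apply: differentiableD => //; apply: differentiable_comp => //.
  exact/linear_differentiable/linear_continuous.
by apply/funext => z; rewrite diff_lagrangian.
Qed.

Lemma multipliers_adjoint x l l' :
  multipliers f g K x 0 0 l -> multipliers f g K x 0 0 l' ->
  adjoint ('d g x) l = adjoint ('d g x) l'.
Proof.
move=> [/= + _] [/= + _]; rewrite !gradient_lagrangian => <- /eqP.
by rewrite (inj_eq (addrI _)) => /eqP.
Qed.

End KKTEstimates.

(** * Stability of KKT points *)

Section StrongCalmness.
Context {R : realType} {X Y Z : euclideanType R}.
Variables (f : X -> R) (g : X -> Y) (K : set Y) (xbar : X) (lbar : Y).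
Variables (U : set Y) (D : set Z) (Xi : Y -> Z).
Hypotheses (f_C2 : C2_on setT f) (g_C2 : C2_on setT g).
Hypothesis K_convex : convex_set (K : set (convex_lmodType Y)).
Hypothesis reduction : is_C2_reduction K (g xbar) U D Xi.

Let dg x : differentiable g x. Proof. by have [] := g_C2 (I : setT x). Qed.
Let ddg x v : differentiable (fun z => 'd g z v) x.
Proof. by have [] := g_C2 (I : setT x). Qed.

(** By [normal_cone_vertex] the [m] found at the perturbed point is normal at the vertex too, so
    [adjoint ('d Xi (g xbar)) m] can replace [l] at the fixed point [g xbar], up to a first-order
    error. [C] is the sum of the constants of the three estimates. *)
Lemma kkt_lift : exists C r : R, [/\ 0 < C, 0 < r &
  forall x a b l, `|x - xbar| < r -> `|b| < r -> S_KKT f g K a b (x, l) ->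
  exists m, [/\ normal_cone D (Xi (g xbar)) m,
    l = adjoint ('d Xi (g x - b)) m, `|m| <= C * `|l|,
    `|g x - b - g xbar| <= C * (`|x - xbar| + `|b|) &
    `|l - adjoint ('d Xi (g xbar)) m| <= C * (`|x - xbar| + `|b|) * `|m|]].
Proof.
have [c [r1 [c0 r10 mult]]] := normal_cone_multiplier reduction.
have [Cg [r2 [Cg0 r20 gP]]] := differentiable_calm (dg xbar).
have [Ca [r3 [Ca0 r30 aP]]] :=
  adjoint_calm (reduction_differentiable2 reduction).
pose C := c + (Cg + 1) + Ca * (Cg + 1).
have Cg1 : 0 < Cg + 1 by rewrite addr_gt0.
have CaCg : 0 < Ca * (Cg + 1) by rewrite mulr_gt0.
pose q := Num.min r1 r3 / (2 * (Cg + 1)).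
have q0 : 0 < q by rewrite divr_gt0 ?mulr_gt0// lt_min r10.
exists C, (Num.min r2 q); split; [by rewrite !addr_gt0|by rewrite lt_min r20|].
move=> x a b l; rewrite !lt_min => /andP[xr2 xq] /andP[_ bq] [/= _ Nl].
have yle : `|g x - b - g xbar| <= (Cg + 1) * (`|x - xbar| + `|b|).
  rewrite addrAC (le_trans (ler_normB _ _))//.
  have := gP _ xr2; have := normr_ge0 b; have := normr_ge0 (x - xbar).
  have := mulr_ge0 (ltW Cg0) (normr_ge0 b); nra.
have : `|g x - b - g xbar| < Num.min r1 r3.
  rewrite (le_lt_trans yle)//.
  have -> : Num.min r1 r3 = (Cg + 1) * (q + q) by rewrite /q; field; rewrite gt_eqF.
  by rewrite ltr_pM2l// ltrD.
rewrite lt_min => /andP[yr1 yr3].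
have xb0 : 0 <= `|x - xbar| + `|b| by rewrite addr_ge0.
have [m [Nm lE mle]] := mult _ l Nl.1 yr1 Nl.
exists m; split => //.
- exact: (normal_cone_vertex reduction Nm).
- by rewrite (le_trans mle)// ler_wpM2r// /C; lra.
- by rewrite (le_trans yle)// ler_wpM2r// /C; lra.
rewrite {1}lE (le_trans (aP _ yr3 m))// ler_wpM2r//.
apply: (@le_trans _ _ (Ca * ((Cg + 1) * (`|x - xbar| + `|b|)))).
  by rewrite ler_wpM2l// ltW.
by rewrite mulrA ler_wpM2r// /C; lra.
Qed.

Hypothesis kkt : S_KKT f g K 0 0 (xbar, lbar).
Variable lh : Y.
Hypothesis lh_ri : relative_interior (normal_cone K (g xbar)) lh.
Hypothesis lh_mult : multipliers f g K xbar 0 0 lh.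

Let normal_lbar : normal_cone K (g xbar) lbar.
Proof. by have [/= _] := kkt; rewrite subr0. Qed.

Let K_gxbar : K (g xbar). Proof. by case: normal_lbar. Qed.

Let U_gxbar : U (g xbar). Proof. by case: reduction => -[]. Qed.

(** [l] is replaced by the normal [p] at [g xbar]; stationarity bounds [A p - A lh] by a multiple of
    [e], and [normal_cone_affine_regularity] moves [p] to a multiplier. Since [l] stays near [lbar],
    the factor [1 + |p|] is bounded. The term [|x - xbar|] on the right is left to
    [primal_estimate]. *)
Lemma multiplier_distance : exists C r : R, [/\ 0 < C, 0 < r &
  forall x a b l, `|x - xbar| < r -> `|b| < r -> `|l - lbar| < r ->
    S_KKT f g K a b (x, l) -> exists q, multipliers f g K xbar 0 0 q /\
      `|l - q| <= C * (`|x - xbar| + `|a| + `|b|)].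
Proof.
have [C1 [r1 [C10 r10 lift]]] := kkt_lift.
have [C2 [r2 [C20 r20 ag]]] := adjoint_calm (ddg xbar).
have [C3 [r3 [C30 r30 gradf]]] : exists C r : R, [/\ 0 < C, 0 < r &
    forall z, `|z - xbar| < r -> `|gradient f z - gradient f xbar| <= C * `|z - xbar|].
  apply: differentiable_calm; apply: gradient_differentiable => v.
  by have [] := f_C2 (I : setT xbar).
pose A := adjoint_lin ('d g xbar).
have [C4 C40 regA] := normal_cone_affine_regularity A K_gxbar lh_ri.
have [C5 C50 A_le] := linear_bounded A.
have [C6 C60 adj_le] := linear_bounded (adjoint_lin ('d Xi (g xbar))).
pose L := `|lbar| + 1; pose M := C1 * L.
have L0 : 0 < L by rewrite ltr_wpDl.
have M0 : 0 < M by rewrite mulr_gt0.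
pose Cp := C1 * M.
pose Crho := C5 * Cp + 1 + C3 + C2 * L.
have Cp0 : 0 < Cp by rewrite mulr_gt0.
have Crho0 : 0 < Crho.
  by rewrite !addr_gt0// ?mulr_gt0.
have CM0 : 0 < 1 + C6 * M by rewrite addr_gt0// mulr_gt0.
exists (Cp + C4 * Crho * (1 + C6 * M)), (Num.min (Num.min r1 r2) (Num.min r3 1)).
split; [by rewrite addr_gt0// !mulr_gt0|by rewrite !lt_min r10 r20 r30 ltr01|].
move=> x a b l; rewrite !lt_min => /andP[/andP[xr1 xr2] /andP[xr3 _]].
move=> /andP[/andP[br1 _] _] /andP[_ /andP[_ l1]] kktx.
set e := _ + _ + _.
have xe : `|x - xbar| <= e.
  by rewrite /e; have := normr_ge0 a; have := normr_ge0 b; lra.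
have ae : `|a| <= e.
  by rewrite /e; have := normr_ge0 (x - xbar); have := normr_ge0 b; lra.
have xbe : `|x - xbar| + `|b| <= e by rewrite /e; have := normr_ge0 a; lra.
have e0 : 0 <= e by rewrite (le_trans _ ae).
have lL : `|l| <= L.
  rewrite -(subrK lbar l) (le_trans (ler_normD _ _))// /L addrC lerD2l.
  exact: ltW.
have [m [Nm lE mle _ lp]] := lift _ _ _ _ xr1 br1 kktx.
have mM : `|m| <= M by rewrite (le_trans mle)// ler_pM2l.
set p := adjoint ('d Xi (g xbar)) m in lp.
have Np : normal_cone K (g xbar) p.
  exact: (normal_cone_adjoint K_convex reduction).
have lpe : `|l - p| <= Cp * e.
  rewrite (le_trans lp)// /Cp mulrAC ler_pM ?mulr_ge0 ?(ltW C10)//.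
  by rewrite ler_pM2l.
have pM : `|p| <= C6 * M by rewrite (le_trans (adj_le m))// ler_pM2l.
have rho_le : `|A p - A lh| <= Crho * e.
  have -> : A p - A lh = A (p - l) + a + (gradient f xbar - gradient f x)
      + (adjoint ('d g xbar) l - adjoint ('d g x) l).
    have aE : a = gradient f x + adjoint ('d g x) l.
      by rewrite -gradient_lagrangian//; case: kktx.
    have -> : A lh = - gradient f xbar.
      apply/eqP; rewrite -addr_eq0 addrC -gradient_lagrangian//.
      by case: lh_mult => /= ->.
    have cancel (u0 u1 u2 u3 u4 : X) :
        u0 + u4 = u0 - u1 + (u2 + u3) + (u4 - u2) + (u1 - u3).
      by apply: inner_inj => v; rewrite !(innerDl, innerNl); ring.
    rewrite opprK linearB/= aE; exact: cancel.
  rewrite (le_trans (ler_normD _ _))// /Crho mulrDl lerD//; last first.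
    rewrite distrC (le_trans (ag _ xr2 l))// mulrAC ler_pM ?mulr_ge0 ?(ltW C20)//.
    by rewrite ler_pM2l.
  rewrite (le_trans (ler_normD _ _))// mulrDl lerD//; last first.
    by rewrite distrC (le_trans (gradf _ xr3))// ler_pM2l.
  rewrite (le_trans (ler_normD _ _))// mulrDl mul1r lerD//.
  by rewrite (le_trans (A_le _))// -mulrA ler_pM2l// distrC.
have [q [Nq Aq qp]] := regA p Np.
exists q; split.
  split=> /=; last by rewrite subr0.
  have [/= + _] := lh_mult; rewrite !gradient_lagrangian// => <-.
  by congr (_ + _).
rewrite -(subrKA p) (le_trans (ler_normD _ _))// mulrDl lerD//.
rewrite distrC (le_trans qp)//.
have -> : C4 * Crho * (1 + C6 * M) * e = C4 * (Crho * e) * (1 + C6 * M) by ring.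
by rewrite ler_pM ?addr_ge0 ?mulr_ge0 ?(ltW C40)// ?ler_pM2l// lerD2l.
Qed.

End StrongCalmness.

(** * Blow-up and the estimate of the primal variable *)

Lemma ultrafilter_fmap (T V : Type) (u : T -> V) (G : set_system T) :
  UltraFilter G -> UltraFilter (u @ G).
Proof.
move=> GU; split; first exact: fmap_proper_filter.
move=> H HP uGH; apply/seteqP; split=> [A HA|]; last exact: uGH.
have [//|nA] := in_ultra_setVsetC (u @^-1` A) GU.
have /filter_ex[z [zA]] : H (A `&` ~` A) by apply: filterI => //; exact: uGH.
by move=> /(_ zA).
Qed.

Section PrimalEstimate.
Context {R : realType} {X Y Z : euclideanType R}.
Variables (f : X -> R) (g : X -> Y) (K : set Y) (xbar : X) (lbar : Y).
Variables (U : set Y) (D : set Z) (Xi : Y -> Z) (mu : Z).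
Hypotheses (f_C2 : C2_on setT f) (g_C2 : C2_on setT g).
Hypothesis K_convex : convex_set (K : set (convex_lmodType Y)).
Hypothesis reduction : is_C2_reduction K (g xbar) U D Xi.
Hypothesis kkt : S_KKT f g K 0 0 (xbar, lbar).
Hypothesis mu_normal : normal_cone D (Xi (g xbar)) mu.
Hypothesis mu_lbar : lbar = adjoint ('d Xi (g xbar)) mu.
Variable lh : Y.
Hypothesis lh_ri : relative_interior (normal_cone K (g xbar)) lh.
Hypothesis lh_mult : multipliers f g K xbar 0 0 lh.
Hypothesis Sigma_Gamma : forall xi zeta,
  (Sigma_set f g (Upsilon Xi mu (g xbar)) xbar lbar
     `&` Gamma_tilde g K xbar lbar) (xi, zeta) ->
  0 <= inner ('d g xbar xi) zeta.
Hypothesis nc : noncritical f g K xbar lbar.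

Let dg x : differentiable g x. Proof. by have [] := g_C2 (I : setT x). Qed.
Let ddg x v : differentiable (fun z => 'd g z v) x.
Proof. by have [] := g_C2 (I : setT x). Qed.

Let normal_lbar : normal_cone K (g xbar) lbar.
Proof. by have [/= _] := kkt; rewrite subr0. Qed.

Let K_gxbar : K (g xbar). Proof. by case: normal_lbar. Qed.

Let U_gxbar : U (g xbar). Proof. by case: reduction => -[]. Qed.

Let A := adjoint_lin ('d g xbar).

(* Along a subsequence violating the estimate, the directions [xi] and the
   scaled multiplier increments converge to a pair that the sign condition turns
   into a solution of the generalized equation defining criticality. *)
Lemma no_critical_sequence (G : set_system nat) (FG : ProperFilter G)
    (t : nat -> R) (xi : nat -> X) (a : nat -> X) (b : nat -> Y) (l : nat -> Y)
    (m : nat -> Z) (xi0 : X) :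
  (forall k, 0 < t k) -> t @ G --> (0 : R) -> xi @ G --> xi0 ->
  (forall k, S_KKT f g K (t k *: a k) (t k *: b k) (xbar + t k *: xi k, l k)) ->
  a @ G --> (0 : X) -> b @ G --> (0 : Y) -> l @ G --> lbar -> m @ G --> mu ->
  (forall k, normal_cone D (Xi (g xbar)) (m k)) ->
  (forall k, l k = adjoint ('d Xi (g (xbar + t k *: xi k) - t k *: b k)) (m k)) ->
  xi0 = 0.
Proof.
move=> t0 tG xiG kktk aG bG lG mG Nm lE.
pose B := adjoint_lin ('d Xi (g xbar)).
pose h k := (t k)^-1 *: (g (xbar + t k *: xi k) - g xbar) - b k.
pose h0 := 'd g xbar xi0.
have hG : h @ G --> h0.
  rewrite -[X in _ --> X]subr0; apply: cvgB => //.
  exact: cvg_difference_quotient.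
have yE k : g (xbar + t k *: xi k) - t k *: b k = g xbar + t k *: h k.
  rewrite /h scalerBr scalerA mulfV ?gt_eqF// scale1r addrA.
  by rewrite subrKC.
have Kh : contingent_cone K (g xbar) h0.
  apply: (contingent_cone_filter t0 tG hG); near=> k.
  by rewrite -yE; have [_ []] := kktk k.
(* One inequality is polarity at [g xbar]; the other is the limit of the normality of [l k] at the
   perturbed point, tested at [g xbar]. *)
have lh0 : inner lbar h0 = 0.
  apply/eqP; rewrite eq_le (normal_cone_contingent normal_lbar Kh)/=.
  have lhG : (fun k => inner (l k) (h k)) @ G --> inner lbar h0 by exact: cvg_inner.
  apply: (closed_cvg (fun x : R => 0 <= x) _ _ _ lhG); first exact: closed_ge.
  near=> k; have [_ [_ /(_ _ K_gxbar)]] := kktk k.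
  rewrite /= yE opprD addrA subrr sub0r innerNr innerZr oppr_le0.
  by rewrite pmulr_rge0.
pose w := 2^-1 *: gradient (Upsilon Xi mu (g xbar)) h0.
have wG : (fun k => (t k)^-1 *: (l k - B (m k))) @ G --> w.
  rewrite (_ : (fun _ => _) = (fun k => (t k)^-1 *:
    (adjoint ('d Xi (g xbar + t k *: h k)) (m k) - adjoint ('d Xi (g xbar)) (m k)))).
    exact: (cvg_adjoint_quotient (reduction_differentiable reduction)
      (reduction_differentiable2 reduction)).
  by apply/funext => k; rewrite lE yE.
pose H := hessian (lagrangian f g lbar) xbar xi0.
have HG : (fun k => (t k)^-1 *: (gradient (lagrangian f g lbar) (xbar + t k *: xi k)
    - gradient (lagrangian f g lbar) xbar)) @ G --> H.
  by apply: cvg_difference_quotient => //; exact: gradient_lagrangian_differentiable.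
have adjG : (fun k => (t k)^-1 *: (adjoint ('d g (xbar + t k *: xi k)) (l k - lbar)
    - adjoint ('d g xbar) (l k - lbar))) @ G --> (0 : X).
  have dlG : (fun k => l k - lbar) @ G --> (0 : Y).
    by rewrite -(subrr lbar); apply: cvgB => //; exact: cvg_cst.
  (* The curvature limit for [g] with the multipliers [l k - lbar]: these tend to [0], and the
     curvature term of the zero multiplier vanishes. *)
  have -> : (0 : X) = 2^-1 *: gradient (Upsilon g (0 : Y) xbar) xi0.
    rewrite gradient_Upsilon; [|exact: nearW|by []].
    by rewrite big1// => u _; rewrite inner0l scale0r.
  by apply: cvg_adjoint_quotient => //; exact: nearW.
(* This sequence may be unbounded; the stationarity equations express only [A (s k)] through
   convergent quotients. *)
pose s k := (t k)^-1 *: (B (m k) - lbar).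
have Ss k : normal_span K (g xbar) (s k).
  rewrite /s -[_ *: _]addr0; apply: normal_span_lin; last exact: normal_span0.
  by apply: normal_span_sub => //; exact: (normal_cone_adjoint K_convex reduction).
have AsE k : A (s k) = a k
    - (t k)^-1 *: (gradient (lagrangian f g lbar) (xbar + t k *: xi k)
                   - gradient (lagrangian f g lbar) xbar)
    - (t k)^-1 *: (adjoint ('d g (xbar + t k *: xi k)) (l k - lbar)
                   - adjoint ('d g xbar) (l k - lbar))
    - A ((t k)^-1 *: (l k - B (m k))).
  have [/= akE _] := kktk k; have [/= L0 _] := kkt.
  have -> : a k = (t k)^-1 *: (gradient (lagrangian f g (l k)) (xbar + t k *: xi k)
                 - gradient (lagrangian f g lbar) xbar).
    by rewrite akE L0 subr0 scalerA mulVf ?scale1r// gt_eqF.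
  rewrite /s/= !adjointZ -!scalerBr; congr (_ *: _).
  have cancel (p p0 q q0 r r0 r1 : X) : r1 - r0 =
      p + q - (p0 + r0) - (p + q0 - (p0 + r0)) - (q - q0 - (r - r0)) - (r - r1).
    by apply: inner_inj => v; rewrite !(innerDl, innerNl); ring.
  rewrite !(gradient_lagrangian f_C2 g_C2) !adjointB; exact: cancel.
have AsG : (fun k => A (s k)) @ G --> - H - A w.
  have -> : - H - A w = 0 - H - 0 - A w by rewrite sub0r subr0.
  under eq_fun do rewrite AsE.
  apply: cvgB; first by apply: cvgB => //; exact: cvgB.
  by apply: continuous_cvg => //; exact: linear_continuous.
have [Q [SQ AQ]] := subspace_section A (normal_span0 K_gxbar) (@normal_span_lin _ _ K _).
(* [A \o Q] is continuous and fixes every [A (s k)], hence it fixes their limit. *)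
have AQlim : A (Q (- H - A w)) = - H - A w.
  have cG : (fun k => A (Q (A (s k)))) @ G --> A (Q (- H - A w)).
    apply: continuous_cvg; first exact: linear_continuous.
    by apply: continuous_cvg => //; exact: linear_continuous.
  rewrite (_ : (fun k => _) = (fun k => A (s k))) in cG; last first.
    by apply/funext => k; exact: AQ.
  by apply: (cvg_unique _ cG AsG); exact: norm_hausdorff.
have [e e0 eP] := relative_interior_normal_cone lh_ri.
pose z0 := Q (- H - A w).
have [ep ep0 epz] : exists2 ep : R, 0 < ep & ep * `|z0| < e.
  exists (e / (`|z0| + 1)); first by rewrite divr_gt0// ltr_wpDl.
  by rewrite mulrAC ltr_pdivrMr ?ltr_wpDl// ltr_pM2l// ltrDl.
have Nn1 : normal_cone K (g xbar) (lh + ep *: z0).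
  apply: eP; last by rewrite normrZ gtr0_norm.
  by rewrite -[_ *: _]addr0; apply: normal_span_lin; [exact: SQ|exact: normal_span0].
pose n := ep^-1 *: (lh + ep *: z0).
have Nn : normal_cone K (g xbar) n.
  by apply: normal_coneZ => //; rewrite invr_ge0 ltW.
(* As [A lh = A lbar], subtracting [ep^-1 *: lbar] from [n] leaves exactly the image of [z0]. *)
pose zeta := n + (- ep^-1) *: lbar.
have Azeta : A zeta = - H - A w.
  rewrite -AQlim -/z0 /zeta /n linearD !(linearZZ A) linearD (linearZZ A).
  rewrite -[A lh]/(adjoint _ _) (multipliers_adjoint f_C2 g_C2 lh_mult kkt).
  rewrite scalerDr scalerA mulVf ?gt_eqF// scale1r scaleNr.
  by rewrite addrAC subrr add0r.
have hl0 : inner h0 lbar = 0 by rewrite innerC.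
have crit : critical_cone K (g xbar) lbar h0 by split.
have h_zeta : inner h0 zeta = inner n h0.
  by rewrite /zeta innerDr (innerZr _ _ lbar) hl0 mulr0 addr0 innerC.
have nh : inner n h0 = 0.
  apply/eqP; rewrite eq_le (normal_cone_contingent Nn Kh)/= -h_zeta.
  apply: Sigma_Gamma; split.
    rewrite /Sigma_set/= -/H -/h0 -/w -[adjoint _ _]/(A (zeta + w)) linearD Azeta.
    by rewrite subrK subrr.
  split => //=; exists n, (- ep^-1 *: lbar); split => //.
  by exists (- ep^-1).
have gd := graphical_derivative_normal_cone K_convex reduction
  (- ep^-1) K_gxbar mu_normal mu_lbar crit Nn nh.
suff : [set 0] xi0 by [].
rewrite -nc; exists (w + zeta); first exact: gd.
by rewrite -/H -[adjoint _ _]/(A (w + zeta)) linearD Azeta [A w + _]addrC subrK subrr.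
Unshelve. all: by end_near. Qed.

Lemma primal_estimate : exists C r : R, [/\ 0 < C, 0 < r &
  forall x a b l, `|x - xbar| < r -> `|b| < r -> `|l - lbar| < r ->
    S_KKT f g K a b (x, l) -> `|x - xbar| <= C * (`|a| + `|b|)].
Proof.
have [C1 [r1 [C10 r10 lift]]] := kkt_lift f g_C2 reduction.
have [c [r2 [c0 r20 coer]]] := adjoint_coercive reduction.
(* Coercivity at [g xbar] itself turns the convergence of the transported multipliers to [lbar] into
   convergence of [m] to [mu]. *)
have {r2 r20 coer} coer m : `|m| <= c * `|adjoint ('d Xi (g xbar)) m|.
  by have [|_ ] := coer (g xbar); rewrite ?subrr ?normr0.
apply: contrapT => noC.
(* The cap [r1] makes [kkt_lift] applicable to every term of the sequence. *)
pose eps n : R := Num.min n.+1%:R^-1 r1.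
have eps0 n : 0 < eps n by rewrite lt_min invr_gt0 ltr0n.
have bad n : exists p : X * X * (Y * Y), [/\ `|p.1.1 - xbar| < eps n,
    `|p.2.1| < eps n, `|p.2.2 - lbar| < eps n,
    S_KKT f g K p.1.2 p.2.1 (p.1.1, p.2.2) &
    n.+1%:R * (`|p.1.2| + `|p.2.1|) < `|p.1.1 - xbar|].
  apply: contrapT => nobad; apply: noC; exists n.+1%:R, (eps n); split => //.
  move=> x a b l xe be le kktx; rewrite leNgt; apply/negP => lt.
  by apply: nobad; exists ((x, a), (b, l)).
have {bad}/choice[p pP] := bad.
pose t k := `|(p k).1.1 - xbar|.
have t0 k : 0 < t k.
  have [_ _ _ _] := pP k; apply: le_lt_trans.
  by rewrite mulr_ge0// addr_ge0.
have epsn n : eps n <= n.+1%:R^-1 by rewrite ge_min lexx.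
have epsr n : eps n <= r1 by rewrite ge_min lexx orbT.
have to0 (E : normedModType R) (u : nat -> E) (v : E) (M : R) :
    (forall k, `|u k - v| <= M * k.+1%:R^-1) -> u @ \oo --> v.
  move=> uM; apply/cvgrPdist_le => e e_gt0.
  have Mh : (fun k => M * harmonic k) @ \oo --> (0 : R).
    by rewrite -(mulr0 M); apply: cvgM; [exact: cvg_cst|exact: cvg_harmonic].
  move/cvgrPdist_le : Mh => /(_ _ e_gt0); apply: filterS => k.
  rewrite sub0r normrN distrC => /(le_trans _); apply.
  exact: le_trans (uM k) (ler_norm _).
have /choice[m mP] k : exists m, [/\ normal_cone D (Xi (g xbar)) m,
    (p k).2.2 = adjoint ('d Xi (g (p k).1.1 - (p k).2.1)) m &
    `|m - mu| <= c * (1 + C1 * 2 * (C1 * (`|lbar| + 1))) * k.+1%:R^-1].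
  have [xe be le kktx _] := pP k.
  have [m [Nm lE ml _ lm]] := lift _ _ _ _ (lt_le_trans xe (epsr k))
    (lt_le_trans be (epsr k)) kktx.
  exists m; split => //; apply: le_trans (coer _) _.
  rewrite adjointB -mu_lbar -mulrA ler_pM2l//.
  have k1 : k.+1%:R^-1 <= 1 :> R by rewrite invf_le1// ler1n.
  have lL : `|(p k).2.2| <= `|lbar| + 1.
    rewrite -(subrK lbar (p k).2.2) (le_trans (ler_normD _ _))// addrC lerD2l.
    by rewrite (le_trans (ltW le))// (le_trans (epsn k)).
  rewrite distrC -(subrKA (p k).2.2) (le_trans (ler_normD _ _))// mulrDl mul1r.
  apply: lerD; first by rewrite distrC (le_trans (ltW le)).
  have -> : C1 * 2 * (C1 * (`|lbar| + 1)) / k.+1%:R =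
    C1 * (k.+1%:R^-1 + k.+1%:R^-1) * (C1 * (`|lbar| + 1)) by ring.
  rewrite (le_trans lm)// ler_pM ?mulr_ge0 ?addr_ge0 ?(ltW C10)//.
    by rewrite ler_pM2l// lerD// (le_trans (ltW _) (epsn k)).
  by rewrite (le_trans ml)// ler_pM2l.
(* An ultrafilter containing the filter [\oo]: limits along [\oo] persist, and compactness of the
   ball yields a limit of [xi] without extracting a subsequence. *)
have [G [GU oG]] : exists G : set_system nat, UltraFilter G /\ \oo `<=` G.
  exact: ultraFilterLemma.
have ccv (V : normedModType R) (u : nat -> V) (v : V) : u @ \oo --> v -> u @ G --> v.
  by move=> uv P /uv /oG.
pose xi k := (t k)^-1 *: ((p k).1.1 - xbar).
have xi1 k : `|xi k| = 1 by rewrite normrZ normfV gtr0_norm// mulVf// (gt_eqF (t0 k)).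
have xi_ball : (xi @ G) [set x : X | `|x - 0| <= 1].
  by apply: (filterE (F := G)) => k; rewrite /= subr0 -/(xi k) xi1.
have : compact [set x : X | `|x - 0| <= 1] by exact: closed_ball_compact.
rewrite compact_ultra => /(_ _ (ultrafilter_fmap xi GU) xi_ball)[xi0 [_ xiG]].
have xE k : xbar + t k *: xi k = (p k).1.1.
  by rewrite scalerA mulfV ?gt_eqF// scale1r subrKC.
have aE (V : lmodType R) (v : V) k : t k *: ((t k)^-1 *: v) = v.
  by rewrite scalerA mulfV ?gt_eqF// scale1r.
have quot0 (V : normedModType R) (v : V) k : k.+1%:R * `|v| < t k ->
    `|(t k)^-1 *: v - 0| <= 1 * k.+1%:R^-1.
  move=> vt; rewrite subr0 mul1r normrZ normfV gtr0_norm// ler_pdivrMl//.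
  by rewrite ler_pdivlMr// mulrC ltW.
have xi0E : xi0 = 0.
  apply: (no_critical_sequence _ t0 _ xiG (a := fun k => (t k)^-1 *: (p k).1.2)
    (b := fun k => (t k)^-1 *: (p k).2.1) (l := fun k => (p k).2.2) (m := m)).
  - apply: ccv; apply: (to0 _ _ _ 1) => k; rewrite subr0 mul1r.
    rewrite (gtr0_norm (t0 k)).
    by have [xe _ _ _ _] := pP k; rewrite (le_trans (ltW xe)).
  - by move=> k; rewrite xE !aE; have [_ _ _ + _] := pP k.
  - apply: ccv; apply: (to0 _ _ _ 1) => k; apply: quot0.
    have [_ _ _ _] := pP k; apply: le_lt_trans.
    by rewrite ler_pM2l// lerDl.
  - apply: ccv; apply: (to0 _ _ _ 1) => k; apply: quot0.
    have [_ _ _ _] := pP k; apply: le_lt_trans.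
    by rewrite ler_pM2l// lerDr.
  - apply: ccv; apply: (to0 _ _ _ 1) => k; rewrite mul1r.
    by have [_ _ le _ _] := pP k; rewrite (le_trans (ltW le)).
  - by apply: ccv; apply: to0 => k; have [_ _] := mP k; exact.
  - by move=> k; have [] := mP k.
  - by move=> k; rewrite xE aE; have [] := mP k.
have : (fun k => `|xi k|) @ G --> `|xi0| by exact: cvg_norm.
rewrite xi0E normr0 (_ : (fun k => _) = (fun=> 1)); last exact/funext.
move=> c10; have : (1 : R) = 0.
  by apply: (cvg_unique _ (cvg_cst (1 : R)) c10); exact: norm_hausdorff.
by move/eqP; rewrite oner_eq0.
Qed.

End PrimalEstimate.

Theorem theorem4p1 (R : realType) (X Y : euclideanType R)
    (f : X -> R) (g : X -> Y) (K : set Y)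
    (f_C2 : C2_on setT f) (g_C2 : C2_on setT g)
    (K_nonempty : K !=set0) (K_closed : closed K)
    (K_convex : convex_set (K : set (convex_lmodType Y)))
    (K_reducible : C2_cone_reducible K)
    (xbar : X) (lbar : Y)
    (kkt : S_KKT f g K 0 0 (xbar, lbar))
    (Z : euclideanType R) (U : set Y) (D : set Z) (Xi : Y -> Z)
    (reduction : is_C2_reduction K (g xbar) U D Xi)
    (mu : Z) (mu_normal : normal_cone D (Xi (g xbar)) mu)
    (mu_lbar : lbar = adjoint ('d Xi (g xbar)) mu)
    (not_unique : multipliers f g K xbar 0 0 <> [set lbar])
    (subregular : metrically_subregular
                    (fun x : X => [set g x - k | k in K]) xbar 0)
    (Sigma_Gamma : forall xi zeta,
       (Sigma_set f g (Upsilon Xi mu (g xbar)) xbar lbar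
          `&` Gamma_tilde g K xbar lbar) (xi, zeta) ->
       0 <= inner ('d g xbar xi) zeta)
    (ri_multiplier :
       relative_interior (normal_cone K (g xbar))
         `&` multipliers f g K xbar 0 0 !=set0) :
  noncritical f g K xbar lbar -> strong_calmness f g K xbar lbar.
Proof.
move=> nc; have [lh [lh_ri lh_mult]] := ri_multiplier.
have [C1 [r1 [C10 r10 primal]]] := primal_estimate f_C2 g_C2 K_convex reduction
  kkt mu_normal mu_lbar lh_ri lh_mult Sigma_Gamma nc.
have [C2 [r2 [C20 r20 dual]]] := multiplier_distance f_C2 g_C2 K_convex
  reduction kkt lh_ri lh_mult.
pose r := Num.min r1 r2; have r0 : 0 < r by rewrite lt_min r10.
have [r_r1 r_r2] : r <= r1 /\ r <= r2 by rewrite !ge_min !lexx orbT.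
have pair_fst (V W : euclideanType R) (v : V) (w : W) : `|v| <= pair_norm (v, w).
  rewrite -[leLHS](ger0_norm (normr_ge0 v)) -sqrtr_sqr ler_wsqrtr//.
  by rewrite lerDl sqr_ge0.
have pair_snd (V W : euclideanType R) (v : V) (w : W) : `|w| <= pair_norm (v, w).
  rewrite -[leLHS](ger0_norm (normr_ge0 w)) -sqrtr_sqr ler_wsqrtr//.
  by rewrite lerDr sqr_ge0.
(* Halving [r] makes the bounds strict. The constants come from [|a| + |b| <= 2 P] and
   [|x - xbar| + |a| + |b| <= (2 C1 + 2) P]. *)
exists (r / 2), (r / 2), (2 * C1 + C2 * (2 * C1 + 2)).
split; rewrite ?divr_gt0 ?addr_gt0 ?mulr_gt0 ?addr_gt0 ?mulr_gt0//.
move=> a b abr x l kktx xlr.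
set P := pair_norm (a, b) in abr *.
have aP : `|a| <= P by exact: pair_fst.
have bP : `|b| <= P by exact: pair_snd.
have xr : `|x - xbar| < r by have := pair_fst _ _ (x - xbar) (l - lbar); lra.
have lr : `|l - lbar| < r by have := pair_snd _ _ (x - xbar) (l - lbar); lra.
have br : `|b| < r by lra.
have x_le : `|x - xbar| <= 2 * C1 * P.
  rewrite (le_trans (primal x a b l _ _ _ kktx))//; try exact: lt_le_trans r_r1.
  by rewrite [2 * C1]mulrC -mulrA ler_pM2l//; lra.
have [q [Mq lq]] : exists q, multipliers f g K xbar 0 0 q /\
    `|l - q| <= C2 * (`|x - xbar| + `|a| + `|b|).
  by apply: dual => //; exact: lt_le_trans r_r2.
have lq_le : `|l - q| <= C2 * (2 * C1 + 2) * P.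
  by rewrite (le_trans lq)// -mulrA ler_pM2l//; lra.
apply: (@le_trans _ _ (`|x - xbar| + `|l - q|)%:E).
  by rewrite EFinD leeD2l//; apply: ereal_inf_lbound; exists q.
by rewrite lee_fin mulrDl lerD.
Qed.
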